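(* Let $M$ be a connected compact manifold of finite dimension $m\ge 3$, let $X$ be a $C^1$ vector field on $M$ (inwardly transverse to $\partial M$ if $\partial M\neq\emptyset$) with flow $X_t$, and let $\Gamma\subset M$ be a uniformly hyperbolic set for $X$ with splitting $T_\Gamma M=E^s\oplus E^X\oplus E^u$. Put $E=E^s$ and $F=E^X\oplus E^u$. Then $\Gamma$ admits a sectional-adapted metric, i.e. there exist a Riemannian metric on $T_\Gamma M$ with induced norm $|\cdot|$ and a constant $\lambda>0$ such that for all $x\in\Gamma$, all $t>0$ and all $2$-dimensional linear subspaces $L_x\subset F_x$ $$|DX_t|_{E_x}|\cdot|(DX_t|_{F_x})^{-1}|\le e^{-\lambda t},\qquad |DX_t|_{E_x}|\le e^{-\lambda t},\qquad |\det(DX_t|_{L_x})|\ge e^{\lambda t}.$$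
   Context: A (uniformly) hyperbolic set for the flow $X_t$ is a compact invariant set $\Gamma$ with a continuous $DX_t$-invariant splitting $T_\Gamma M=E^s\oplus E^X\oplus E^u$, where $E^X_x=\mathbb{R}X(x)$ is the one-dimensional direction of the vector field (so $\Gamma$ contains no singularities, i.e. $X(x)\neq 0$ for $x\in\Gamma$), and for some (equivalently any) Riemannian metric on $M$ with norm $\|\cdot\|$ there are $K,\lambda>0$ such that $\|DX_t|_{E^s_x}\|\le Ke^{-\lambda t}$ and $\|(DX_t|_{E^u_x})^{-1}\|\le Ke^{-\lambda t}$ for all $x\in\Gamma$, $t>0$. A Riemannian metric on $T_\Gamma M$ means a continuously varying family of inner products on the spaces $T_xM$, $x\in\Gamma$. Determinants and operator norms in the conclusion are computed with respect to the metric asserted to exist; $\det(DX_t|_{L_x})$ is the determinant of $DX_t:L_x\to DX_t(L_x)$. *)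

(* Defs.v *)
From mathcomp Require Import all_boot all_order all_algebra.
From mathcomp Require Import all_classical all_reals all_analysis.

Set Implicit Arguments.
Unset Strict Implicit.
Unset Printing Implicit Defensive.

Import Order.TTheory GRing.Theory Num.Theory.
Import numFieldNormedType.Exports.

Local Open Scope classical_set_scope.
Local Open Scope ring_scope.

Section Calculus.
Variables (R : realType) (m n : nat).
Implicit Types (A V : set 'rV[R]_m) (f g : 'rV[R]_m -> 'rV[R]_n).

                                                                          
                                                                             
Definition has_deriv_within A f (a : 'rV[R]_m) (L : 'M[R]_(m, n)) : Prop :=
  forall e : R, 0 < e -> \forall y \near within A (nbhs a),
    `|f y - f a - (y - a) *m L| <= e * `|y - a|.

Definition deriv_within A f (a : 'rV[R]_m) : 'M[R]_(m, n) :=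
  xget 0 [set L | has_deriv_within A f a L].

                              
Fixpoint class_C (k : nat) V f : Prop :=
  match k with
  | 0 => forall a, V a -> {for a, continuous f}
  | k'.+1 => (forall a, V a -> differentiable f a) /\
             (forall v : 'rV[R]_m, class_C k' V (fun a => 'D_v f a))
  end.

                                                                       
                                                              
Definition extends_locally (P : set 'rV[R]_m -> ('rV[R]_m -> 'rV[R]_n) -> Prop)
    A f : Prop :=
  forall a, A a -> exists V g,
    [/\ open_nbhs a V, P V g & forall y, V y -> A y -> g y = f y].

Definition smooth_on A f : Prop :=
  extends_locally (fun V g => forall k, class_C k V g) A f.

Definition C1_on A f : Prop := extends_locally (class_C 1) A f.

End Calculus.

                                          
Definition half_space (R : realType) (m : nat) : set 'rV[R]_m :=
  [set y | forall j : 'I_m, j = 0%N :> nat -> 0 <= y 0 j].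
Arguments half_space : clear implicits.

                                                                              
                                                                               
                                                                              
                                                                          
                                                                        
Record smooth_manifold (R : realType) (m : nat) (M : topologicalType) : Type :=
  SmoothManifold {
  dom : M -> set M;
  chart : M -> M -> 'rV[R]_m;
  cinv : M -> 'rV[R]_m -> M;
  manifold_hausdorff : hausdorff_space M;
  dom_open : forall p, open (dom p);
  dom_self : forall p, dom p p;
  chart_image : forall p, exists2 V : set 'rV[R]_m,
    open V & chart p @` dom p = V `&` half_space R m;
  chartK : forall p x, dom p x -> cinv p (chart p x) = x;
  chart_continuous : forall p, {within dom p, continuous (chart p)};
  cinv_continuous : forall p,
    {within chart p @` dom p, continuous (cinv p)};
  transition_smooth : forall p q,
    smooth_on (chart p @` (dom p `&` dom q)) (chart q \o cinv p)
}.

Section Manifold.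
Variables (R : realType) (m : nat) (M : topologicalType).
Variable S : smooth_manifold R m M.

                                                                      
                              

                                                                     
                                           
Definition local_dom (p q : M) (f : M -> M) : set 'rV[R]_m :=
  chart S p @` (dom S p `&` f @^-1` dom S q).

Definition local_map (p q : M) (f : M -> M) : 'rV[R]_m -> 'rV[R]_m :=
  chart S q \o f \o cinv S p.

Definition local_diff (p q : M) (f : M -> M) (x : M) : 'M[R]_m :=
  deriv_within (local_dom p q f) (local_map p q f) (chart S p x).

                                
Definition mdiff (f : M -> M) (x : M) : 'M[R]_m := local_diff x (f x) f x.

                                                                               
                 
Definition tchange (p q x : M) : 'M[R]_m := local_diff p q id x.

                                                                             
                                 
Definition C1_vector_field (X : M -> 'rV[R]_m) : Prop :=
  forall p, C1_on (chart S p @` dom S p)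
    (fun y => X (cinv S p y) *m tchange (cinv S p y) p (cinv S p y)).

                                                                    
Definition inward_at_boundary (X : M -> 'rV[R]_m) : Prop :=
  forall (x : M) (j : 'I_m), j = 0%N :> nat ->
    chart S x x 0 j = 0 -> 0 < X x 0 j.

                                                                              
                                                                          
                                                
                                                                 
                                               
Record is_flow (X : M -> 'rV[R]_m) (Phi : R -> M -> M) : Prop := IsFlow {
  flow0 : forall x, Phi 0 x = x;
  flowD : forall (s t : R) x, 0 <= s -> 0 <= t -> Phi (s + t) x = Phi s (Phi t x);
  flowN : forall (t : R) x, 0 <= t -> Phi (- t) (Phi t x) = x;
  flow_continuous : {within [set tx : R * M | 0 <= tx.1],
    continuous (fun tx => Phi tx.1 tx.2)};
  flow_deriv : forall (t : R) x, 0 <= t ->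
    (fun s => (s - t)^-1 *:
       (chart S (Phi t x) (Phi s x) - chart S (Phi t x) (Phi t x)))
      @ within [set s | 0 <= s] (dnbhs t) --> X (Phi t x);
  flow_C1_diff : forall (t : R) p q x, 0 <= t -> dom S p x -> dom S q (Phi t x) ->
    exists L, has_deriv_within (local_dom p q (Phi t)) (local_map p q (Phi t))
                (chart S p x) L;
  flow_C1_cont : forall p q,
    {within [set tx : R * M |
               [/\ 0 <= tx.1, dom S p tx.2 & dom S q (Phi tx.1 tx.2)]],
     continuous (fun tx => local_diff p q (Phi tx.1) tx.2)}
}.

Definition invariant_set (Phi : R -> M -> M) (Gamma : set M) : Prop :=
  forall t : R, 0 <= t -> Phi t @` Gamma = Gamma.

                                                                           
                              
Definition continuous_subbundle (A : set M) (E : M -> 'M[R]_m) : Prop :=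
  forall p, A p -> exists (k : nat) (U : set M) (B : M -> 'M[R]_(k, m)),
    [/\ open_nbhs p U, U `<=` dom S p,
        {within A `&` U, continuous B} &
        forall x, A x -> U x ->
          row_free (B x) /\ (B x :=: E x *m tchange x p x)%MS].

Definition invariant_subbundle (Phi : R -> M -> M) (A : set M)
    (E : M -> 'M[R]_m) : Prop :=
  forall x (t : R), A x -> 0 <= t ->
    (E x *m mdiff (Phi t) x :=: E (Phi t x))%MS.

                                                                   
Definition riemannian_metric (A : set M) (g : M -> 'M[R]_m) : Prop :=
  [/\ forall x, A x -> (g x)^T = g x,
      forall x (v : 'rV[R]_m), A x -> v != 0 -> 0 < (v *m g x *m v^T) 0 0 &
      forall p, {within A `&` dom S p, continuous
        (fun x => tchange p x x *m g x *m (tchange p x x)^T)}].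

End Manifold.

Section InnerProduct.
Variables (R : realType) (m : nat).
Implicit Types (G : 'M[R]_m) (A : 'M[R]_m).

Definition inorm G (v : 'rV[R]_m) : R := Num.sqrt ((v *m G *m v^T) 0 0).

                                                                              
                                
Definition opnorm G G' (V : 'M[R]_m) A : R :=
  sup [set inorm G' (v *m A) | v in
        [set v : 'rV[R]_m | (v <= V)%MS /\ inorm G v <= 1]].

Definition orthonormal_basis G (V : 'M[R]_m) (k : nat) (e : 'M[R]_(k, m)) :
    Prop :=
  e *m G *m e^T = 1%:M /\ (e :=: V)%MS.

                                                                           
                                                                            
                                                                            
                                   
Definition absdet G G' (V : 'M[R]_m) A : R :=
  xget 0 [set d | exists e f : 'M[R]_(\rank V, m),
    [/\ orthonormal_basis G V e, orthonormal_basis G' (V *m A) f &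
        d = `| \det (e *m A *m G' *m f^T) |]].

End InnerProduct.

Section Hyperbolicity.
Variables (R : realType) (m : nat) (M : topologicalType).
Variable S : smooth_manifold R m M.
Variables (X : M -> 'rV[R]_m) (Phi : R -> M -> M).
Implicit Types (g Es Eu E F : M -> 'M[R]_m) (Gamma : set M).

                      
Definition flow_dir (x : M) : 'M[R]_m := <<X x>>%MS.

                   
Definition norm_restr g E (t : R) (x : M) : R :=
  opnorm (g x) (g (Phi t x)) (E x) (mdiff S (Phi t) x).

                                                                          
                                                                                
Definition norm_restr_inv g E (t : R) (x : M) : R :=
  opnorm (g (Phi t x)) (g x) (E x *m mdiff S (Phi t) x)
         (invmx (mdiff S (Phi t) x)).

Record hyperbolic_set Gamma Es Eu : Prop := HyperbolicSet {
  hyp_compact : compact Gamma;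
  hyp_invariant : invariant_set Phi Gamma;
  hyp_regular : forall x, Gamma x -> X x != 0;
  hyp_splitting : forall x, Gamma x ->
    (1%:M <= Es x + flow_dir x + Eu x)%MS /\
    mxdirect (Es x + flow_dir x + Eu x);
  hyp_continuous : [/\ continuous_subbundle S Gamma Es,
    continuous_subbundle S Gamma flow_dir & continuous_subbundle S Gamma Eu];
  hyp_inv_splitting : [/\ invariant_subbundle S Phi Gamma Es,
    invariant_subbundle S Phi Gamma flow_dir &
    invariant_subbundle S Phi Gamma Eu];
  hyp_rates : exists g, riemannian_metric S [set: M] g /\
    exists K lambda : R, [/\ 0 < K, 0 < lambda &
      forall x (t : R), Gamma x -> 0 < t ->
        norm_restr g Es t x <= K * expR (- lambda * t) /\
        norm_restr_inv g Eu t x <= K * expR (- lambda * t)]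
}.

                                                                              
                                           
Definition sectional_adapted_metric Gamma E F g : Prop :=
  riemannian_metric S Gamma g /\
  exists lambda : R, 0 < lambda /\
    forall x (t : R), Gamma x -> 0 < t ->
      [/\ norm_restr g E t x * norm_restr_inv g F t x <= expR (- lambda * t),
          norm_restr g E t x <= expR (- lambda * t) &
          forall L : 'M[R]_m, (L <= F x)%MS -> \rank L = 2 ->
            expR (lambda * t) <=
            absdet (g x) (g (Phi t x)) L (mdiff S (Phi t) x)].

End Hyperbolicity.

(* Main.v *)
Require Import Defs.
From mathcomp Require Import all_boot all_order all_algebra.
From mathcomp Require Import all_classical all_reals all_analysis.
From mathcomp Require Import ring lra.
Set Implicit Arguments.
Unset Strict Implicit.
Unset Printing Implicit Defensive.
Import Order.TTheory GRing.Theory Num.Theory.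
Import numFieldNormedType.Exports.
Local Open Scope classical_set_scope.
Local Open Scope ring_scope.

(** The metric is the orthogonal sum of three metrics, one on each summand of the
    splitting. On the flow direction the field [X] is declared a unit vector.
    On [Es] and on [Eu] the given metric is averaged along the flow: the square
    of the new norm of [v] is the integral over [0 <= s <= T] of
    [expR (c * s) * |DX_s v|^2], with [c = lambda] on [Es] and [c = - lambda] on
    [Eu]. Only positive times occur, also on [Eu].

    Applying [DX_t] multiplies the average by [expR (- c * t)] and moves the
    window of integration from the interval from [0] to [T] to the one from [t]
    to [t + T]. If [T] is so long that [K ^+ 2 * expR (- lambda * T) <= 1], then
    the hyperbolic estimates at time [T] say that the weighted integrand does
    not increase over a period [T] on [Es], and does not decrease on [Eu].
    The integral over a moving window is then monotone ([itg_translate_le]),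
    and the square of the new norm is contracted on [Es], and expanded on [Eu],
    by [expR (lambda * t)] at all times [t > 0] and with no constant
    ([averaged_metric_contract], [averaged_metric_expand]).

    The derivative of the flow maps [X] to [X] ([vector_field_invariant]), hence
    is an isometry between flow directions. On [F], the sum of the flow
    direction and [Eu], its inverse is therefore a weak contraction, and
    the domination of [Es] by [F] follows from the contraction of [Es]. For a
    plane in [F] the metric is a square, the contribution of the flow direction,
    plus a form that is stretched by [expR (lambda * t)]. A square has rank one,
    so at least one direction of the plane is stretched and areas grow
    ([det_stretch]); the determinant of the problem is turned into a Gram
    determinant by [absdet_gram].

    It remains to see that the metric is continuous. The derivative of the flow
    read in charts satisfies a cocycle rule ([flow_diff_comp]) which contains
    the rules for changing charts, since [Phi 0] is the identity. With it the
    integrand is continuous in time and space, and so is its integral, by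
    compactness of the interval ([cvg_averaged_metric]). The projections to the
    summands solve linear systems with continuous coefficients, given by local
    frames ([cvg_splitting]). *)

(** * Quadratic forms, operator norms and determinants *)

Section QuadraticForms.
Variables (R : realType) (m : nat).
Implicit Types (G A V : 'M[R]_m) (v w : 'rV[R]_m).

Definition qform n (G : 'M[R]_n) (v : 'rV[R]_n) : R := (v *m G *m v^T) 0 0.

Definition posdef G : Prop := G^T = G /\ forall v, v != 0 -> 0 < qform G v.

Lemma qform0 G : qform G 0 = 0.
Proof. by rewrite /qform !mul0mx mxE. Qed.

Lemma qformZ G (c : R) v : qform G (c *: v) = c ^+ 2 * qform G v.
Proof.
by rewrite /qform linearZ /= -!scalemxAl -scalemxAr !mxE expr2 mulrA.
Qed.

Lemma qform_mul n (G : 'M[R]_m) (B : 'M[R]_(n, m)) (c : 'rV[R]_n) :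
  qform G (c *m B) = qform (B *m G *m B^T) c.
Proof. by rewrite /qform trmx_mul !mulmxA. Qed.

Lemma qformD n (G H : 'M[R]_n) (v : 'rV[R]_n) : qform (G + H) v = qform G v + qform H v.
Proof. by rewrite /qform mulmxDr mulmxDl mxE. Qed.

Lemma qformZl n (c : R) (G : 'M[R]_n) (v : 'rV[R]_n) :
  qform (c *: G) v = c * qform G v.
Proof. by rewrite /qform -scalemxAr -scalemxAl mxE. Qed.

Lemma qform_ge0 G v : posdef G -> 0 <= qform G v.
Proof.
move=> [_ Gpos]; case: (eqVneq v 0) => [->|/Gpos /ltW //].
by rewrite qform0.
Qed.

Lemma inorm_ge0 G v : 0 <= inorm G v.
Proof. exact: sqrtr_ge0. Qed.

Lemma inorm0 G : inorm G 0 = 0.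
Proof. by rewrite /inorm -/(qform G 0) qform0 sqrtr0. Qed.

Lemma inormZ G (c : R) v : inorm G (c *: v) = `|c| * inorm G v.
Proof. by rewrite /inorm -!/(qform _ _) qformZ sqrtrM ?sqr_ge0 // sqrtr_sqr. Qed.

Lemma inorm_gt0 G v : posdef G -> v != 0 -> 0 < inorm G v.
Proof. by move=> [_ Gpos] v0; rewrite sqrtr_gt0 Gpos. Qed.

Lemma inorm_leE G G' v w (c : R) : posdef G -> 0 <= c ->
  (inorm G' w <= c * inorm G v) = (qform G' w <= c ^+ 2 * qform G v).
Proof.
move=> Gp c0; rewrite -[X in X * inorm _ _](ger0_norm c0) -inormZ -qformZ.
by rewrite /inorm -!/(qform _ _) ler_sqrt // qform_ge0.
Qed.

Lemma gram_schmidt G : posdef G ->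
  forall k (B : 'M[R]_(k, m)), row_free B ->
  exists e : 'M[R]_(k, m), e *m G *m e^T = 1%:M /\ (e :=: B)%MS.
Proof.
move=> [Gsym Gpos]; elim=> [|k IH] B Bfree.
  by exists B; split => //; apply/matrixP => i; case: (i).
pose b : 'rV[R]_m := usubmx (B : 'M[R]_(1 + k, m)).
pose B' : 'M[R]_(k, m) := dsubmx (B : 'M[R]_(1 + k, m)).
have defB : B = col_mx b B' :> 'M[R]_(1 + k, m) by rewrite vsubmxK.
have rkB : \rank (col_mx b B') = k.+1 by rewrite -defB; apply/eqP.
have bNB' : ~~ (b <= B')%MS.
  apply/negP => bB'; have : (\rank (col_mx b B') <= k)%N.
    rewrite (leq_trans _ (rank_leq_row B')) // mxrankS //.
    by rewrite col_mx_sub bB' submx_refl.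
  by rewrite rkB ltnn.
have B'free : row_free B'.
  rewrite /row_free eqn_leq rank_leq_row /= -ltnS -rkB -addsmxE.
  have [h _] := mxrank_adds_leqif b B'; rewrite (leq_trans h) //.
  exact: leq_add (rank_leq_row b) (leqnn _).
have [e' [e'1 e'B']] := IH _ B'free.
pose w := b - b *m G *m e'^T *m e'.
have we' : w *m G *m e'^T = 0.
  by rewrite !mulmxBl -!mulmxA (mulmxA e') e'1 mulmx1 subrr.
have w0 : w != 0.
  apply: contra bNB' => /eqP /subr0_eq ->.
  by rewrite -e'B' submxMl.
pose c := (Num.sqrt (qform G w))^-1.
have c0 : c != 0 by rewrite invr_eq0 gt_eqF // sqrtr_gt0 Gpos.
have cw : c ^+ 2 * qform G w = 1.
  by rewrite exprVn sqr_sqrtr ?mulVf // ?gt_eqF ?Gpos // ltW ?Gpos.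
pose e : 'M[R]_(1 + k, m) := col_mx (c *: w) e'.
have e1 : e *m G *m e^T = 1%:M.
  rewrite mul_col_mx tr_col_mx mul_col_row e'1 -!scalemxAl we' scaler0.
  have -> : e' *m G *m (c *: w)^T = 0.
    apply: trmx_inj; rewrite trmx0 !trmx_mul trmxK Gsym mulmxA.
    by rewrite -!scalemxAl we' scaler0.
  have -> : c *: (w *m G *m (c *: w)^T) = 1%:M.
    apply/matrixP => i j; rewrite !ord1 linearZ /= -scalemxAr scalerA mxE.
    by rewrite -expr2 cw mxE.
  by rewrite -scalar_mx_block.
exists e; split; first exact: e1.
have eE : (e :=: c *: w + e')%MS by apply: eqmx_sym; exact: addsmxE.
have BE : (B :=: b + B')%MS by rewrite defB; apply: eqmx_sym; exact: addsmxE.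
apply/eqmxP/andP; split.
  rewrite eE BE addsmx_sub; apply/andP; split.
    rewrite scalemx_sub // addmx_sub ?addsmxSl // eqmx_opp.
    by rewrite (submx_trans (submxMl _ _)) // e'B' addsmxSr.
  by rewrite e'B' addsmxSr.
rewrite eE BE addsmx_sub; apply/andP; split.
  have -> : b = c^-1 *: (c *: w) + b *m G *m e'^T *m e'.
    by rewrite scalerA mulVf // scale1r /w subrK.
  rewrite addmx_sub //; first by rewrite scalemx_sub // addsmxSl.
  by rewrite (submx_trans (submxMl _ _)) // addsmxSr.
by rewrite -e'B' addsmxSr.
Qed.

Lemma orthonormal_basis_exists G V : posdef G ->
  exists e : 'M[R]_(\rank V, m), orthonormal_basis G V e.
Proof.
move=> Gp; have [e [e1 eV]] := gram_schmidt Gp (row_base_free V).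
by exists e; split => //; apply: eqmx_trans eV (eq_row_base V).
Qed.

(** In an orthonormal basis of [G] the form [N] is at most the sum of the moduli
    of its coefficients. This keeps the sets whose suprema are operator norms
    bounded, so that these suprema are genuine. *)
Lemma qform_dominated G N : posdef G ->
  exists2 C : R, 0 <= C & forall v, qform N v <= C * qform G v.
Proof.
move=> Gp; have [] := @gram_schmidt _ Gp _ 1%:M; first by rewrite row_free_unit unitmx1.
move=> e [e1 efull]; pose N' := e *m N *m e^T.
exists (\sum_i \sum_j `|N' i j|); first by do 2![apply: sumr_ge0 => ? _].
move=> v; have /submxP[c ->] : (v <= e)%MS by rewrite efull submx1.
rewrite !qform_mul e1 -/N' {1}/qform mxE.
have q1 : qform 1%:M c = \sum_i c 0 i ^+ 2.
  by rewrite /qform mulmx1 mxE; apply: eq_bigr => i _; rewrite mxE expr2.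
rewrite q1; under eq_bigr => j _ do rewrite mxE mulr_suml.
rewrite exchange_big mulr_suml /=; apply: ler_sum => i _.
rewrite mulr_suml; apply: ler_sum => j _; rewrite [c^T j 0]mxE.
(* Each product of coordinates is bounded by half the sum of their squares. *)
have ci k : c 0 k ^+ 2 <= \sum_l c 0 l ^+ 2.
  by rewrite (bigD1 k) //= lerDl sumr_ge0 // => ? _; exact: sqr_ge0.
rewrite (mulrC (c 0 i)) -mulrA (le_trans (ler_norm _)) // normrM.
rewrite ler_wpM2l // ler_norml.
have := ci i; have := ci j; set s := \sum_l _.
move: (c 0 i) (c 0 j) => x y hy hx.
have := sqr_ge0 (x - y); have := sqr_ge0 (x + y).
by move=> hD hB; apply/andP; split; nra.
Qed.

Lemma has_sup_opnorm G G' V A : posdef G ->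
  has_sup [set inorm G' (v *m A) | v in
        [set v : 'rV[R]_m | (v <= V)%MS /\ inorm G v <= 1]].
Proof.
move=> Gp; split.
  by exists (inorm G' (0 *m A)), 0 => //=; rewrite sub0mx inorm0.
have [C C0 hC] := qform_dominated (A *m G' *m A^T) Gp.
exists (Num.sqrt C) => _ [v [_ v1] <-].
have vC : inorm G' (v *m A) <= Num.sqrt C * inorm G v.
  by rewrite inorm_leE // ?sqrtr_ge0 // sqr_sqrtr // qform_mul hC.
rewrite (le_trans vC) //.
by rewrite -[leRHS]mulr1 ler_wpM2l // sqrtr_ge0.
Qed.

Lemma opnorm_ge0 G G' V A : posdef G -> 0 <= opnorm G G' V A.
Proof.
move=> Gp; apply: ub_le_sup; first by case: (has_sup_opnorm G' V A Gp).
by exists 0; rewrite ?mul0mx ?inorm0 //= sub0mx inorm0.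
Qed.

Lemma inorm_le_opnorm G G' V A v : posdef G -> (v <= V)%MS ->
  inorm G' (v *m A) <= opnorm G G' V A * inorm G v.
Proof.
move=> Gp vV; case: (eqVneq v 0) => [->|v0].
  by rewrite mul0mx !inorm0 mulr0.
have r0 := inorm_gt0 Gp v0; rewrite -ler_pdivrMr //.
apply: ub_le_sup; first by case: (has_sup_opnorm G' V A Gp).
have ri : 0 <= (inorm G v)^-1 by rewrite invr_ge0 ltW.
exists ((inorm G v)^-1 *: v).
  by rewrite /= inormZ ger0_norm // mulVf ?gt_eqF // scalemx_sub.
by rewrite -scalemxAl inormZ ger0_norm // mulrC.
Qed.

Lemma opnorm_le G G' V A (c : R) : 0 <= c ->
  (forall v, (v <= V)%MS -> inorm G' (v *m A) <= c * inorm G v) ->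
  opnorm G G' V A <= c.
Proof.
move=> c0 h; apply: ge_sup.
  by exists (inorm G' (0 *m A)), 0 => //=; rewrite sub0mx inorm0.
move=> _ [v [vV v1] <-]; rewrite (le_trans (h _ vV)) //.
by rewrite -[leRHS]mulr1 ler_wpM2l.
Qed.

(** If [C] is the matrix of [A] in the orthonormal bases [e] and [f], then
    [e *m A = C *m f], and [C *m C^T] is the Gram matrix of [e *m A]. So the
    square of the determinant is a Gram determinant, in which the basis [f] no
    longer appears. *)
Lemma absdet_gram G G' V A : posdef G -> posdef G' -> A \in unitmx ->
  exists e : 'M[R]_(\rank V, m), orthonormal_basis G V e /\
    absdet G G' V A ^+ 2 = \det (e *m A *m G' *m (e *m A)^T).
Proof.
move=> Gp Gp' Au.
have rkVA : \rank (V *m A) = \rank V by rewrite mxrankMfree // row_free_unit.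
have [e0 oe0] := orthonormal_basis_exists V Gp.
have [f0 [f01 f0V]] := gram_schmidt Gp' (row_base_free (V *m A)).
have [f1 of1] : exists f : 'M[R]_(\rank V, m), orthonormal_basis G' (V *m A) f.
  have f0V' := eqmx_trans f0V (eq_row_base (V *m A)).
  by move: f0 f01 {f0V} f0V'; rewrite rkVA => f0 f01 f0V; exists f0.
rewrite /absdet; case: xgetP => [d _ [e [f [oe [f1G fVA] dE]]]|]; last first.
  move=> /(_ `|\det (e0 *m A *m G' *m f1^T)|) []; exists e0, f1.
  by split.
exists e; split => //; rewrite dE.
have /submxP[C eC] : (e *m A <= f)%MS by rewrite fVA submxMr // oe.2.
have -> : e *m A *m G' *m f^T = C by rewrite eC -!mulmxA (mulmxA f) f1G mulmx1.
rewrite eC trmx_mul -!mulmxA (mulmxA f) (mulmxA (f *m _)) f1G mul1mx det_mulmx det_tr.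
by rewrite -expr2 real_normK ?num_real.
Qed.

Lemma det2E (M : 'M[R]_2) :
  \det M = M 0 0 * M 1 1 - M 0 1 * M 1 0.
Proof.
rewrite (expand_det_row _ ord0) !big_ord_recl big_ord0 addr0 /cofactor.
rewrite !det_mx11 !mxE /= expr0 mul1r expr1 mulN1r mulrN.
have l1 (i : 'I_1) : lift ord0 i = 1 :> 'I_2 by apply: val_inj; rewrite ord1.
have l0 (i : 'I_1) : lift 1 i = 0 :> 'I_2 by apply: val_inj; rewrite ord1.
by rewrite !l1 !l0.
Qed.

Lemma qform2E (M : 'M[R]_2) (x y : R) :
  qform M (\row_j (if j == 0 then x else y)) =
  x ^+ 2 * M 0 0 + x * y * (M 0 1 + M 1 0) + y ^+ 2 * M 1 1.
Proof.
rewrite /qform mxE !big_ord_recl big_ord0 !mxE /=.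
rewrite !big_ord_recl !big_ord0 !mxE /=.
have -> : lift ord0 ord0 = 1 :> 'I_2 by apply: val_inj.
by rewrite /=; ring.
Qed.

(** The determinant of a sum of two semidefinite forms of the plane is the sum
    of their determinants and of a mixed term, which is nonnegative by the
    inequality of Cauchy and Schwarz. *)
Lemma det2_le (N N' : 'M[R]_2) : N^T = N -> N'^T = N' ->
  (forall c, 0 <= qform N c) -> (forall c, qform N c <= qform N' c) ->
  \det N <= \det N'.
Proof.
move=> Nsym N'sym Npos NN'.
have sN : N 1 0 = N 0 1 by rewrite -[in RHS]Nsym mxE.
have sN' : N' 1 0 = N' 0 1 by rewrite -[in RHS]N'sym mxE.
rewrite !det2E sN sN'.
have hN x y : 0 <= x ^+ 2 * N 0 0 + x * y * (N 0 1 *+ 2) + y ^+ 2 * N 1 1.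
  have := Npos (\row_j (if j == 0 then x else y)).
  by rewrite qform2E sN mulr2n.
have hW x y : 0 <= x ^+ 2 * (N' 0 0 - N 0 0) +
    x * y * ((N' 0 1 - N 0 1) *+ 2) + y ^+ 2 * (N' 1 1 - N 1 1).
  have := NN' (\row_j (if j == 0 then x else y)).
  by rewrite !qform2E sN sN' !mulr2n => ?; lra.
have psd (p q r : R) : (forall x y, 0 <= x ^+ 2 * p + x * y * (q *+ 2) + y ^+ 2 * r) ->
    [/\ 0 <= p, 0 <= r & q ^+ 2 <= p * r].
  move=> h; have p0 : 0 <= p by have := h 1 0; lra.
  split=> //; first by have := h 0 1; lra.
  case: (ltrP 0 p) => [p_gt0|p_le0].
    rewrite -subr_ge0 -(pmulr_rge0 _ p_gt0).
    (* The form is evaluated on the kernel of its first row. *)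
    suff <- : q ^+ 2 * p + q * - p * (q *+ 2) + (- p) ^+ 2 * r =
      p * (p * r - q ^+ 2) by exact: h.
    by ring.
  have p00 : p = 0 by lra.
  subst p.
  rewrite mul0r -oppr_ge0.
  (* This point is chosen so that the value of the form is [- q ^+ 2]. *)
  suff -> : - q ^+ 2 = (- (r + 1) / 2) ^+ 2 * 0 + - (r + 1) / 2 * q * (q *+ 2) +
    q ^+ 2 * r by exact: h.
  by field.
have [p0 r0 qpr] := psd _ _ _ hN; have [p0' r0' qpr'] := psd _ _ _ hW.
move: (N 0 0) (N 0 1) (N 1 1) p0 r0 qpr => p q r p0 r0 qpr in hN hW p0' r0' qpr' *.
move: p0' r0' qpr' {hN hW psd NN' Npos}.
have -> : N' 0 0 = p + (N' 0 0 - p) by ring.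
have -> : N' 0 1 = q + (N' 0 1 - q) by ring.
have -> : N' 1 1 = r + (N' 1 1 - r) by ring.
move: (N' 0 0 - p) (N' 0 1 - q) (N' 1 1 - r) => a b c.
rewrite !(addrC p) !(addrC q) !(addrC r) !addrK => a0 c0 bac.
have mixed : (2 * (b * q)) ^+ 2 <= (a * r + c * p) ^+ 2.
  apply: (@le_trans _ _ (4 * ((a * c) * (p * r)))).
    have -> : (2 * (b * q)) ^+ 2 = 4 * (b ^+ 2 * q ^+ 2) by ring.
    by rewrite ler_pM2l ?ltr0n // ler_pM ?sqr_ge0.
  rewrite -subr_ge0.
  have -> : (a * r + c * p) ^+ 2 - 4 * (a * c * (p * r)) = (a * r - c * p) ^+ 2 by ring.
  exact: sqr_ge0.
have ar : 0 <= a * r + c * p by rewrite addr_ge0 ?mulr_ge0.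
have : 2 * (b * q) <= a * r + c * p.
  have := le_trans (ler_norm (2 * (b * q))) _; apply.
  by rewrite -(ger0_norm ar) -ler_sqr ?nnegrE // !real_normK ?num_real.
nra.
Qed.

(** The form [a *m a^T] has rank one, so at most one direction of the plane
    escapes the stretching of [U], and areas grow by the factor [mu] at least.
    Indeed the determinant for [U' = mu *: U] is [mu * (mu - (mu - 1) * |a|^2)],
    and [|a|^2 <= 1] because [U] is nonnegative at [a]. *)
Lemma det_stretch k (a : 'cV[R]_k) (U U' : 'M[R]_k) (mu : R) : k = 2 -> 1 <= mu ->
  U'^T = U' -> a *m a^T + U = 1%:M ->
  (forall c, 0 <= qform U c) -> (forall c, mu * qform U c <= qform U' c) ->
  mu <= \det (a *m a^T + U').
Proof.
move=> k2; subst k => mu1 U'sym aU U0 UU'.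
have UE : U = 1%:M - a *m a^T by rewrite -aU addrC addKr.
have Usym : U^T = U by rewrite UE linearB /= trmx1 trmx_mul trmxK.
have aasym : (a *m a^T)^T = a *m a^T by rewrite trmx_mul trmxK.
have qa c : 0 <= qform (a *m a^T) c.
  rewrite /qform !mulmxA -mulmxA -[a^T *m c^T]trmx_mul mxE big_ord1.
  rewrite [X in _ * X]mxE -expr2.
  exact: sqr_ge0.
apply: (@le_trans _ _ (\det (a *m a^T + mu *: U))); last first.
  apply: det2_le => [| |c|c].
  - by rewrite linearD linearZ /= aasym Usym.
  - by rewrite linearD /= aasym U'sym.
  - by rewrite qformD qformZl addr_ge0 // mulr_ge0 // (le_trans ler01).
  - by rewrite !qformD qformZl lerD2l.
have := U0 a^T; rewrite UE /qform mulmxBr mulmx1 mulmxBl trmxK.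
have aaE : a^T *m a = (a 0 0 ^+ 2 + a 1 0 ^+ 2)%:M.
  apply/matrixP => i j; rewrite !ord1 !mxE !big_ord_recl big_ord0 !mxE /= addr0.
  have -> : lift ord0 ord0 = 1 :> 'I_2 by apply: val_inj.
  by rewrite !expr2.
rewrite !mulmxA aaE -mulmxA aaE -scalar_mxM !mxE /= !mulr1n.
rewrite det2E !mxE !big_ord1 !mxE /= !mulr1n !mulr0n.
move: (a 0 0) (a 1 0) => x y h.
have n1 : x ^+ 2 + y ^+ 2 <= 1.
  rewrite leNgt; apply/negP => n1.
  have : 0 < (x ^+ 2 + y ^+ 2) * (x ^+ 2 + y ^+ 2 - 1).
    by rewrite mulr_gt0 ?subr_gt0 // (lt_trans ltr01).
  by move: h; nra.
have := mulr_ge0 (_ : 0 <= mu * (mu - 1)) (_ : 0 <= 1 - (x ^+ 2 + y ^+ 2)).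
move=> /(_ _ _); nra.
Qed.

End QuadraticForms.

(** * Integrals over a window of time *)

Section AverageOverTime.
Variable R : realType.
Implicit Types (T t : R) (h : R -> R).

Definition itg T h : R := \int[lebesgue_measure]_(s in `[0, T]) h s.

Lemma continuous_integrable (a b : R) h : continuous h ->
  lebesgue_measure.-integrable `[a, b] (EFin \o h).
Proof.
move=> hc; apply: (continuous_compact_integrable (@segment_compact R a b)).
exact: (continuous_subspaceT hc).
Qed.

Lemma itg_le T h1 h2 : continuous h1 -> continuous h2 ->
  (forall s, 0 <= s <= T -> h1 s <= h2 s) -> itg T h1 <= itg T h2.
Proof.
by move=> c1 c2 h12; apply: le_Rintegral => //; exact: continuous_integrable.
Qed.

Lemma itg_cst T (c : R) : 0 < T -> itg T (fun=> c) = c * T.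
Proof.
move=> T0; rewrite /itg Rintegral_cst //; congr (c * _).
have := @lebesgue_measure_itv R `[0, T]; rewrite /= lte_fin T0 => ->.
by rewrite -EFinD /= subr0.
Qed.

Lemma itgZl T (c : R) h : continuous h -> itg T (fun s => c * h s) = c * itg T h.
Proof. by move=> hc; apply: RintegralZl => //; exact: continuous_integrable. Qed.

Lemma itgB T h1 h2 : continuous h1 -> continuous h2 ->
  itg T (fun s => h1 s - h2 s) = itg T h1 - itg T h2.
Proof. by move=> c1 c2; apply: RintegralB => //; exact: continuous_integrable. Qed.

Lemma continuous_sumr (I : Type) (r : seq I) (f : I -> R -> R) :
  (forall i, continuous (f i)) -> continuous (fun s => \sum_(i <- r) f i s).
Proof.
move=> fc; elim: r => [|i r IH] s.
  rewrite (_ : (fun s => _) = fun=> 0); first exact: cvg_cst.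
  by apply/funext => x; rewrite big_nil.
rewrite (_ : (fun s => _) = fun s => f i s + \sum_(j <- r) f j s).
  by apply: cvgD; [exact: fc|exact: IH].
by apply/funext => x; rewrite big_cons.
Qed.

Lemma itg_sum T (I : Type) (r : seq I) (f : I -> R -> R) :
  0 < T -> (forall i, continuous (f i)) ->
  itg T (fun s => \sum_(i <- r) f i s) = \sum_(i <- r) itg T (f i).
Proof.
move=> T0 fc; elim: r => [|i r IH].
  by under eq_fun do rewrite big_nil; rewrite big_nil itg_cst // mul0r.
rewrite big_cons -IH /itg -RintegralD //.
- by apply: eq_Rintegral => s _; rewrite big_cons.
- exact: continuous_integrable.
- by apply: continuous_integrable; exact: continuous_sumr.
Qed.

Lemma itg_gt0 T h : 0 < T -> continuous h -> (forall s, 0 < h s) -> 0 < itg T h.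
Proof.
move=> T0 hc hpos.
have [c _ hmin] := EVT_min (ltW T0) (continuous_subspaceT (A := `[0, T]) hc).
apply: (@lt_le_trans _ _ (h c * T)); first by rewrite mulr_gt0.
by rewrite -itg_cst //; apply: itg_le => // ?; exact: cvg_cst.
Qed.

Lemma itg_dist T h1 h2 (e : R) : 0 < T -> continuous h1 -> continuous h2 ->
  (forall s, 0 <= s <= T -> `|h1 s - h2 s| <= e) ->
  `|itg T h1 - itg T h2| <= e * T.
Proof.
move=> T0 c1 c2 h12; rewrite -itgB //.
have c12 : continuous (fun s => h1 s - h2 s).
  by move=> s; apply: cvgB; [exact: c1|exact: c2].
have ccst (c : R) : continuous (fun _ : R => c) by move=> ?; exact: cvg_cst.
rewrite ler_norml -mulNr -!itg_cst //; apply/andP; split; apply: itg_le => // s sT;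
  by have := h12 s sT; rewrite ler_norml => /andP[].
Qed.

Lemma primitive_exists h : continuous h ->
  exists H : R -> R, forall x : R, -1 < x -> is_derive x 1 H (h x).
Proof.
move=> hc.
(* Starting at [-1] makes the primitive differentiable on both sides of [0]. *)
exists (fun x => \int[lebesgue_measure]_(t in `[-1, x]) h t) => x x1.
have xx1 : x < x + 1 by rewrite ltrDl.
have hi := continuous_integrable (-1) (x + 1) hc.
have [dH HE] := continuous_FTC1_closed xx1 hi x1 (hc x).
by rewrite -HE derive1E; exact: derivableP dH.
Qed.

Lemma itg_translate T t h (H : R -> R) : 0 < T -> 0 <= t -> continuous h ->
  (forall x : R, -1 < x -> is_derive x 1 H (h x)) ->
  itg T (fun s => h (s + t)) = H (t + T) - H t.
Proof.
move=> T0 t0 hc dH; have lt10 : -1 < 0 :> R by rewrite ltrN10.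
pose K s := H (s + t).
have dK (s : R) : 0 <= s -> is_derive s 1 K (h (s + t)).
  move=> s0; have dHs := dH (s + t) (lt_le_trans lt10 (addr_ge0 s0 t0)).
  rewrite -[h _]mulr1.
  exact: (@is_derive1_comp _ H (shift t) _ _ _ dHs (is_derive_shift s 1 t)).
have cK (s : R) : 0 <= s -> {for s, continuous K}.
  move=> s0; apply/differentiable_continuous/derivable1_diffP.
  by have := dK s s0 => -[].
have hct : continuous (fun s => h (s + t)).
  move=> s; apply: (@continuous_comp _ _ _ (fun s => s + t) h); last exact: hc.
  by apply: cvgD; [exact: cvg_id|exact: cvg_cst].
rewrite /itg /Rintegral (@continuous_FTC2 _ _ K) //.
- by rewrite -EFinB /= /K add0r (addrC T).
- exact: continuous_subspaceT.
- split.
  + by move=> s; rewrite in_itv /= => /andP[/ltW s0 _]; have := dK s s0 => -[].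
  + exact: (cvg_at_right_filter (cK 0 (lexx _))).
  + exact: (cvg_at_left_filter (cK T (ltW T0))).
- move=> s; rewrite in_itv /= => /andP[/ltW s0 _].
  by rewrite derive1E; have := dK s s0 => dKs; rewrite derive_val.
Qed.

(** The integral of [h] over the window of length [T] that starts at [t] has
    derivative [h (t + T) - h t] in [t], so a decay of [h] over the period [T]
    makes it decrease at all times. *)
Lemma itg_translate_le T t h : 0 < T -> 0 <= t -> continuous h ->
  (forall s, 0 <= s -> h (s + T) <= h s) ->
  itg T (fun s => h (s + t)) <= itg T h.
Proof.
move=> T0; rewrite le_eqVlt => /orP[/eqP<- hc _|t0 hc hT].
  by under [in X in X <= _]eq_fun do rewrite addr0.
have lt10 : -1 < 0 :> R by rewrite ltrN10.
have [H dH] := primitive_exists hc.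
rewrite (itg_translate T0 (ltW t0) hc dH).
have -> : itg T h = H (0 + T) - H 0.
  rewrite -(itg_translate T0 (lexx 0) hc dH); congr (itg _ _).
  by apply/funext => s; rewrite addr0.
pose W s := H (s + T) - H s.
have dW (s : R) : 0 <= s -> is_derive s 1 W (h (s + T) - h s).
  move=> s0; have dHs := dH s (lt_le_trans lt10 s0).
  have dHTs := dH (s + T) (lt_le_trans lt10 (addr_ge0 s0 (ltW T0))).
  apply: is_deriveB; rewrite -[h _]mulr1.
  exact: (@is_derive1_comp _ H (shift T) _ _ _ dHTs (is_derive_shift s 1 T)).
have cW (s : R) : 0 <= s -> {for s, continuous W}.
  move=> s0; apply/differentiable_continuous/derivable1_diffP.
  by have := dW s s0 => -[].
apply: (@ler0_derive1_le_cc _ W 0 t) => //; rewrite ?in_itv /= ?lexx ?(ltW t0) //.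
- by move=> s; rewrite in_itv /= => /andP[/ltW s0 _]; have := dW s s0 => -[].
- move=> s; rewrite in_itv /= => /andP[/ltW s0 _].
  have := dW s s0 => dWs; rewrite derive1E derive_val subr_le0.
  exact: hT.
- apply/subspace_continuousP => s; rewrite /= in_itv /= => /andP[s0 _].
  exact: cvg_within_filter (cW s s0).
Qed.

Lemma itg_translate_ge T t h : 0 < T -> 0 <= t -> continuous h ->
  (forall s, 0 <= s -> h s <= h (s + T)) ->
  itg T h <= itg T (fun s => h (s + t)).
Proof.
move=> T0 t0 hc hT.
have hcN : continuous (fun s => -1 * h s).
  by move=> s; apply: cvgM; [exact: cvg_cst|exact: hc].
have hct : continuous (fun s => h (s + t)).
  move=> s; apply: (@continuous_comp _ _ _ (fun s => s + t) h); last exact: hc.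
  by apply: cvgD; [exact: cvg_id|exact: cvg_cst].
have := @itg_translate_le T t (fun s => -1 * h s) T0 t0 hcN.
rewrite !itgZl // !mulN1r lerN2; apply => s s0.
by rewrite !mulN1r lerN2 hT.
Qed.

Lemma itg_eq T h1 h2 : (forall s, 0 <= s <= T -> h1 s = h2 s) ->
  itg T h1 = itg T h2.
Proof.
move=> h12; apply: eq_Rintegral => s; rewrite inE /= in_itv /=; exact: h12.
Qed.

Definition itg_mx m n T (N : R -> 'M[R]_(m, n)) : 'M[R]_(m, n) :=
  \matrix_(i, j) itg T (fun s => N s i j).

Lemma mulmx_itg m n p T (A : 'M[R]_(p, m)) (N : R -> 'M[R]_(m, n)) : 0 < T ->
  (forall i j, continuous (fun s => N s i j)) ->
  A *m itg_mx T N = itg_mx T (fun s => A *m N s).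
Proof.
move=> T0 Nc; apply/matrixP => i j; rewrite !mxE.
under [in RHS]eq_fun do rewrite mxE.
rewrite itg_sum // => [|k s]; last by apply: cvgM; [exact: cvg_cst|exact: Nc].
by apply: eq_bigr => k _; rewrite mxE itgZl.
Qed.

Lemma trmx_itg m n T (N : R -> 'M[R]_(m, n)) :
  (itg_mx T N)^T = itg_mx T (fun s => (N s)^T).
Proof.
by apply/matrixP => i j; rewrite !mxE; under [in RHS]eq_fun do rewrite mxE.
Qed.

Lemma continuous_mulmx m n p (A : 'M[R]_(p, m)) (N : R -> 'M[R]_(m, n)) :
  (forall i j, continuous (fun s => N s i j)) ->
  forall i j, continuous (fun s => (A *m N s) i j).
Proof.
move=> Nc i j; rewrite (_ : (fun s => _) = fun s => \sum_k A i k * N s k j).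
  by apply: continuous_sumr => k s; apply: cvgM; [exact: cvg_cst|exact: Nc].
by apply/funext => s; rewrite mxE.
Qed.

Lemma continuous_trmx m n (N : R -> 'M[R]_(m, n)) :
  (forall i j, continuous (fun s => N s i j)) ->
  forall i j, continuous (fun s => (N s)^T i j).
Proof.
move=> Nc i j; rewrite (_ : (fun s => _) = fun s => N s j i); first exact: Nc.
by apply/funext => s; rewrite mxE.
Qed.

Lemma congr_itg m n T (A : 'M[R]_(n, m)) (N : R -> 'M[R]_m) : 0 < T ->
  (forall i j, continuous (fun s => N s i j)) ->
  A *m itg_mx T N *m A^T = itg_mx T (fun s => A *m N s *m A^T).
Proof.
move=> T0 Nc; apply: trmx_inj; rewrite trmx_mul trmxK mulmx_itg // trmx_itg.
rewrite mulmx_itg ?trmx_itg //; last first.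
  exact: continuous_trmx (continuous_mulmx Nc).
by congr (itg_mx T _); apply/funext => s; rewrite [RHS]trmx_mul trmxK.
Qed.

Lemma qform_sum m (N : 'M[R]_m) (v : 'rV[R]_m) :
  qform N v = \sum_i \sum_j (v 0 i * v 0 j) * N i j.
Proof.
rewrite /qform mxE; under eq_bigr => j _ do rewrite mxE mulr_suml.
rewrite exchange_big /=; apply: eq_bigr => i _; apply: eq_bigr => j _.
by rewrite [v^T j 0]mxE mulrAC.
Qed.

Lemma continuous_qform m (N : R -> 'M[R]_m) (v : 'rV[R]_m) :
  (forall i j, continuous (fun s => N s i j)) ->
  continuous (fun s => qform (N s) v).
Proof.
move=> Nc; rewrite (_ : (fun s => _) =
  (fun s => \sum_i \sum_j (v 0 i * v 0 j) * N s i j)); last first.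
  by apply/funext => s; rewrite qform_sum.
apply: continuous_sumr => i; apply: continuous_sumr => j s.
by apply: cvgM; [exact: cvg_cst|exact: Nc].
Qed.

Lemma qform_itg m T (N : R -> 'M[R]_m) (v : 'rV[R]_m) : 0 < T ->
  (forall i j, continuous (fun s => N s i j)) ->
  qform (itg_mx T N) v = itg T (fun s => qform (N s) v).
Proof.
move=> T0 Nc.
have c1 i j : continuous (fun s => (v 0 i * v 0 j) * N s i j).
  by move=> s; apply: cvgM; [exact: cvg_cst|exact: Nc].
under [in RHS]eq_fun do rewrite qform_sum.
rewrite itg_sum // => [|i]; last by apply: continuous_sumr => j.
rewrite qform_sum; apply: eq_bigr => i _; rewrite itg_sum //.
by apply: eq_bigr => j _; rewrite itgZl // mxE.
Qed.

Lemma posdef_itg m T (N : R -> 'M[R]_m) : 0 < T ->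
  (forall i j, continuous (fun s => N s i j)) -> (forall s, posdef (N s)) ->
  posdef (itg_mx T N).
Proof.
move=> T0 Nc Np; split.
  apply/matrixP => i j; rewrite !mxE; congr (itg T _); apply/funext => s.
  by rewrite -[in LHS](Np s).1 mxE.
move=> v v0; rewrite qform_itg //; apply: itg_gt0 => //.
  exact: continuous_qform.
by move=> s; exact: (Np s).2.
Qed.

(** Compactness of the interval of integration makes the convergence of the
    integrands uniform. *)
Lemma cvg_itg T (I : Type) (F : set_system I) (k : R -> I -> R) (x0 : I) :
  Filter F -> 0 < T ->
  (\forall x \near F, continuous (k^~ x)) -> continuous (k^~ x0) ->
  (forall s0 : R, k sx.1 sx.2 @[sx --> (nbhs s0, F)] --> k s0 x0) ->
  itg T (k^~ x) @[x --> F] --> itg T (k^~ x0).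
Proof.
move=> FF T0 kc k0 kcvg; apply/cvgrPdist_le => e e0.
have eT0 : 0 < e / T by rewrite divr_gt0.
have /compact_near_coveringP Tcov := @segment_compact R 0 T.
have : \forall x \near F, `[0, T]%classic `<=` (fun s => `|k s x0 - k s x| <= e / T).
  apply: Tcov => s0 _.
  have e2 : 0 < e / T / 2 by rewrite divr_gt0.
  have /cvgrPdist_le/(_ _ e2) [[A B] /= [As0 FB] AB] := kcvg s0.
  have /cvgrPdist_le/(_ _ e2) Ck := k0 s0.
  exists ([set s | A s /\ `|k s0 x0 - k s x0| <= e / T / 2], B).
    by split => //=; apply: filterI.
  move=> [s x] [/= [As ks] Bx].
  have := AB (s, x) (conj As Bx) => /= hsx.
  rewrite -[k s x0](subrK (k s0 x0)) -addrA (le_trans (ler_normD _ _)) //.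
  by rewrite [leRHS]splitr lerD // distrC.
apply: filterS2 kc => x kx hx /=.
by rewrite -[leRHS](divfK (lt0r_neq0 T0)); apply: itg_dist.
Qed.

End AverageOverTime.

(** * Limits of matrices *)

Section MatrixLimits.
Variables (R : realType) (I : Type) (F : set_system I).
Context {FF : Filter F}.

Lemma cvg_pair_point (U V : topologicalType) (f : I -> U) (g : I -> V) (a : U) (b : V) :
  f x @[x --> F] --> a -> g x @[x --> F] --> b -> (f x, g x) @[x --> F] --> (a, b).
Proof. by move=> fa gb; apply: (@cvg_pair _ _ _ _ (nbhs a) (nbhs b)). Qed.

Lemma cvg_mx m n (f : I -> 'M[R]_(m, n)) (A : 'M[R]_(m, n)) :
  (forall i j, f x i j @[x --> F] --> A i j) -> f x @[x --> F] --> A.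
Proof.
move=> fA B [P AP PB].
have : \forall x \near F, forall i j, P i j (f x i j).
  by apply: filter_forall => i; apply: filter_forall => j; exact: fA (AP i j).
by apply: filterS => x Px; exact: PB.
Qed.

Lemma cvg_coord m n (f : I -> 'M[R]_(m, n)) (A : 'M[R]_(m, n)) i j :
  f x @[x --> F] --> A -> f x i j @[x --> F] --> A i j.
Proof. by move=> fA; exact: (cvg_comp _ _ fA (@coord_continuous _ _ _ i j A)). Qed.

Lemma cvg_sumr (J : Type) (r : seq J) (P : pred J) (f : J -> I -> R) (a : J -> R) :
  (forall j, P j -> f j x @[x --> F] --> a j) ->
  \sum_(j <- r | P j) f j x @[x --> F] --> \sum_(j <- r | P j) a j.
Proof. by move=> fa; apply: cvg_big => //; exact: add_continuous. Qed.

Lemma cvg_prodr (J : Type) (r : seq J) (P : pred J) (f : J -> I -> R) (a : J -> R) :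
  (forall j, P j -> f j x @[x --> F] --> a j) ->
  \prod_(j <- r | P j) f j x @[x --> F] --> \prod_(j <- r | P j) a j.
Proof. by move=> fa; apply: cvg_big => //; exact: mul_continuous. Qed.

Lemma cvg_mulmx m n p (f : I -> 'M[R]_(m, n)) (g : I -> 'M[R]_(n, p))
    (A : 'M[R]_(m, n)) (B : 'M[R]_(n, p)) :
  f x @[x --> F] --> A -> g x @[x --> F] --> B ->
  f x *m g x @[x --> F] --> A *m B.
Proof.
move=> fA gB; apply: cvg_mx => i j; rewrite mxE; under eq_fun do rewrite mxE.
by apply: cvg_sumr => k _; apply: cvgM; exact: cvg_coord.
Qed.

Lemma cvg_addmx m n (f g : I -> 'M[R]_(m, n)) (A B : 'M[R]_(m, n)) :
  f x @[x --> F] --> A -> g x @[x --> F] --> B -> f x + g x @[x --> F] --> A + B.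
Proof.
move=> fA gB; apply: cvg_mx => i j; rewrite mxE; under eq_fun do rewrite mxE.
by apply: cvgD; exact: cvg_coord.
Qed.

Lemma cvg_scalemx m n (f : I -> R) (g : I -> 'M[R]_(m, n)) (a : R)
    (A : 'M[R]_(m, n)) :
  f x @[x --> F] --> a -> g x @[x --> F] --> A -> f x *: g x @[x --> F] --> a *: A.
Proof.
move=> fa gA; apply: cvg_mx => i j; rewrite mxE; under eq_fun do rewrite mxE.
by apply: cvgM => //; exact: cvg_coord.
Qed.

Lemma cvg_trmx m n (f : I -> 'M[R]_(m, n)) (A : 'M[R]_(m, n)) :
  f x @[x --> F] --> A -> (f x)^T @[x --> F] --> A^T.
Proof.
move=> fA; apply: cvg_mx => i j; rewrite mxE; under eq_fun do rewrite mxE.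
exact: cvg_coord.
Qed.

Lemma cvg_col_mx m1 m2 n (f : I -> 'M[R]_(m1, n)) (g : I -> 'M[R]_(m2, n))
    (A : 'M[R]_(m1, n)) (B : 'M[R]_(m2, n)) :
  f x @[x --> F] --> A -> g x @[x --> F] --> B ->
  col_mx (f x) (g x) @[x --> F] --> col_mx A B.
Proof.
move=> fA gB; apply: cvg_mx => i j; rewrite mxE; under eq_fun do rewrite mxE.
by case: (fintype.split i) => k; exact: cvg_coord.
Qed.

Lemma cvg_det n (f : I -> 'M[R]_n) (A : 'M[R]_n) :
  f x @[x --> F] --> A -> \det (f x) @[x --> F] --> \det A.
Proof.
move=> fA; apply: cvg_sumr => s _; apply: cvgM; first exact: cvg_cst.
by apply: cvg_prodr => i _; exact: cvg_coord.
Qed.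

Lemma cvg_invmx n (f : I -> 'M[R]_n) (A : 'M[R]_n) : A \in unitmx ->
  f x @[x --> F] --> A -> invmx (f x) @[x --> F] --> invmx A.
Proof.
move=> Au fA; have dA : \det A != 0 by rewrite -unitfE -unitmxE.
have nu : \forall x \near F, f x \in unitmx.
  have /cvgr_neq0 : \det (f x) @[x --> F] --> \det A by exact: cvg_det.
  by move=> /(_ dA); apply: filterS => x; rewrite unitmxE unitfE.
apply: cvg_trans (_ : ((\det (f x))^-1 *: \adj (f x)) @[x --> F] --> _).
  by apply: near_eq_cvg; apply: filterS nu => x; rewrite /invmx => ->.
rewrite /invmx Au; apply: cvg_mx => i j; rewrite !mxE.
under eq_fun do rewrite !mxE.
apply: cvgM; first by apply: cvgV => //; exact: cvg_det.
apply: cvgM; first exact: cvg_cst.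
apply: cvg_det; apply: cvg_mx => k l; rewrite !mxE.
by under eq_fun do rewrite !mxE; exact: cvg_coord.
Qed.

(** Over the reals [v *m B^T] vanishes as soon as its sum of squares does. *)
Lemma gram_unitmx k n (B : 'M[R]_(k, n)) : row_full B -> B^T *m B \in unitmx.
Proof.
rewrite -row_free_unit => Bfull; apply: inj_row_free => v vB.
have w0 : v *m B^T = 0.
  have : ((v *m B^T) *m (v *m B^T)^T) 0 0 = 0.
    by rewrite trmx_mul trmxK !mulmxA -(mulmxA v) vB mul0mx mxE.
  rewrite mxE => /eqP; rewrite psumr_eq0 => [|i _]; last first.
    by rewrite [_^T _ _]mxE -expr2 sqr_ge0.
  move=> /allP w0; apply/rowP => i; apply/eqP.
  have /implyP := w0 i (mem_index_enum _); rewrite [_^T _ _]mxE -expr2 sqrf_eq0.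
  by rewrite [X in _ -> _ == X]mxE; apply.
have Bfree : row_free B^T by rewrite /row_free mxrank_tr.
by apply: (row_free_inj Bfree); rewrite w0 mul0mx.
Qed.

(** The left inverse [(B^T B)^-1 B^T] of [B] depends continuously on [B]. So a
    linear map is continuous if its values on a continuous spanning family are;
    the family may have more members than the dimension. *)
Lemma cvg_solve k n p (B : I -> 'M[R]_(k, n)) (P : I -> 'M[R]_(n, p))
    (C : I -> 'M[R]_(k, p)) (B0 : 'M[R]_(k, n)) (P0 : 'M[R]_(n, p))
    (C0 : 'M[R]_(k, p)) :
  row_full B0 -> B x @[x --> F] --> B0 -> C x @[x --> F] --> C0 ->
  (\forall x \near F, B x *m P x = C x) -> B0 *m P0 = C0 ->
  P x @[x --> F] --> P0.
Proof.
move=> full0 BB CC BP BP0.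
have N0u := gram_unitmx full0.
have NN : (B x)^T *m B x @[x --> F] --> B0^T *m B0.
  by apply: cvg_mulmx => //; exact: cvg_trmx.
have nu : \forall x \near F, (B x)^T *m B x \in unitmx.
  have /cvgr_neq0 : \det ((B x)^T *m B x) @[x --> F] --> \det (B0^T *m B0).
    exact: cvg_det.
  rewrite -unitfE -unitmxE => /(_ N0u).
  by apply: filterS => x; rewrite unitmxE unitfE.
have -> : P0 = invmx (B0^T *m B0) *m B0^T *m C0.
  by rewrite -BP0 mulmxA -(mulmxA _ B0^T) mulVmx // mul1mx.
apply: cvg_trans (_ : (invmx ((B x)^T *m B x) *m (B x)^T *m C x) @[x --> F] --> _).
  apply: near_eq_cvg; apply: filterS2 nu BP => x ux <-.
  by rewrite mulmxA -(mulmxA _ (B x)^T) mulVmx // mul1mx.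
apply: cvg_mulmx => //; apply: cvg_mulmx; last exact: cvg_trmx.
exact: cvg_invmx.
Qed.

End MatrixLimits.

(** * Derivatives within a half space *)

Section HalfSpaceDerivative.
Variable R : realType.

Lemma normr_mulmx_le m n (v : 'rV[R]_m) (L : 'M[R]_(m, n)) :
  `|v *m L| <= m%:R * `|L| * `|v|.
Proof.
have le_norm k l (M : 'M[R]_(k, l)) i j : `|M i j| <= `|M|.
  rewrite [leRHS]mx_normrE (bigD1 (i, j)) //=.
  by rewrite comparable_le_max ?lexx // real_comparable ?num_real.
rewrite [leLHS]mx_normrE; apply: bigmax_le => [|[i j] _ /=].
  by rewrite !mulr_ge0 // ?ler0n ?normr_ge0.
rewrite mxE (le_trans (ler_norm_sum _ _ _)) //.
apply: (@le_trans _ _ (\sum_(k < m) `|L| * `|v|)).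
  apply: ler_sum => k _; by rewrite normrM mulrC ler_pM ?normr_ge0 ?le_norm.
by rewrite sumr_const card_ord -mulrA mulr_natl.
Qed.

(** The half space contains a segment in each coordinate direction, so that
    one-sided difference quotients determine the derivative. *)
Lemma half_space_deriv_unique m n (f : 'rV[R]_m -> 'rV[R]_n) (a : 'rV[R]_m)
    (L L' : 'M[R]_(m, n)) :
  half_space R m a -> has_deriv_within (half_space R m) f a L ->
  has_deriv_within (half_space R m) f a L' -> L = L'.
Proof.
move=> Ha dL dL'; apply/subr0_eq/row_matrixP => j; rewrite row0 rowE.
set w : 'rV[R]_m := delta_mx 0 j; set N := L - L'.
apply/eqP; rewrite -normr_le0; apply/ler_addgt0Pr => e e0.
(* Both derivatives are tested, with error [d], at a short step along [w]. *)
pose d := e / (2 * (`|w| + 1)).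
have w1 : 0 < `|w| + 1 by rewrite ltr_wpDl.
have d0 : 0 < d by rewrite divr_gt0 // mulr_gt0.
have : \forall y \near within (half_space R m) (nbhs a),
    `|f y - f a - (y - a) *m L| <= d * `|y - a| /\
    `|f y - f a - (y - a) *m L'| <= d * `|y - a|.
  by apply: filterS2 (dL _ d0) (dL' _ d0).
rewrite near_withinE => /nbhs_ballP [r /= r0 hr].
pose t := r / (`|w| + 1).
have t0 : 0 < t by rewrite divr_gt0.
have Hat : half_space R m (a + t *: w).
  by move=> i i0; rewrite !mxE addr_ge0 ?Ha // mulr_ge0 ?ler0n // ltW.
have bat : ball a r (a + t *: w).
  rewrite mx_norm_ball /ball_ /= opprD addNKr normrN normrZ gtr0_norm //.
  by rewrite /t mulrAC ltr_pdivrMr // ltr_pM2l // ltrDl.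
have [] := hr _ bat Hat; rewrite [a + _]addrC addrK => h1 h2.
have : `|t *: w *m N| <= 2 * d * (t * `|w|).
  move: h1 h2; set q := f _ - f a; rewrite normrZ (gtr0_norm t0) => h1 h2.
  have -> : t *: w *m N = (q - t *: w *m L') - (q - t *: w *m L).
    by rewrite mulmxBr opprB [RHS]addrC addrA subrK.
  rewrite (le_trans (ler_normB _ _)) // -mulrA mulr_natl mulr2n.
  by rewrite lerD.
have -> : 2 * d * (t * `|w|) = t * (2 * d * `|w|) by ring.
rewrite -scalemxAl normrZ (gtr0_norm t0) ler_pM2l // => /le_trans; apply.
have -> : 2 * d * `|w| = e * (`|w| / (`|w| + 1)).
  by rewrite /d; field; rewrite gt_eqF.
by rewrite add0r -[leRHS]mulr1 ler_pM2l // ler_pdivrMr // mul1r lerDl.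
Qed.

Lemma deriv_within_chain m n p (A : set 'rV[R]_m) (B : set 'rV[R]_n)
    (f : 'rV[R]_m -> 'rV[R]_n) (g : 'rV[R]_n -> 'rV[R]_p) (a : 'rV[R]_m)
    (L : 'M[R]_(m, n)) (L' : 'M[R]_(n, p)) :
  has_deriv_within A f a L -> has_deriv_within B g (f a) L' ->
  (\forall y \near within A (nbhs a), B (f y)) ->
  has_deriv_within A (g \o f) a (L *m L').
Proof.
move=> dL dL' AB e e0.
set C := m%:R * `|L|; set C' := n%:R * `|L'|.
have hdiv (c : R) : 0 < c -> e / (2 * c) * c = e / 2.
  by move=> c0; rewrite invfM mulrA divfK // gt_eqF.
have C0 : 0 <= C by rewrite mulr_ge0 ?ler0n ?normr_ge0.
have C'0 : 0 <= C' by rewrite mulr_ge0 ?ler0n ?normr_ge0.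
(* The error of [f] is amplified by [L'], and that of [g] by the Lipschitz bound
   [C + 1] of [f] near [a], which holds because [e1 <= 1]. *)
pose e1 := Num.min 1 (e / (2 * (C' + 1))); pose e2 := e / (2 * (C + 1)).
have C1 : 0 < C + 1 by rewrite ltr_wpDl.
have C'1 : 0 < C' + 1 by rewrite ltr_wpDl.
have e10 : 0 < e1 by rewrite lt_min ltr01 divr_gt0 // mulr_gt0.
have e20 : 0 < e2 by rewrite divr_gt0 // mulr_gt0.
have e11 : e1 <= 1 by rewrite ge_min lexx.
have e1e : C' * e1 <= e / 2.
  apply: (@le_trans _ _ ((C' + 1) * (e / (2 * (C' + 1))))).
    by rewrite ler_pM ?(ltW e10) // ?lerDl // ge_min lexx orbT.
  by rewrite mulrC hdiv.
have e2e : e2 * (C + 1) = e / 2 := hdiv _ C1.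
have fa : f y @[y --> within A (nbhs a)] --> f a.
  apply/cvgrPdist_le => d d0.
  have dC : 0 < d / (C + 1) by rewrite divr_gt0.
  have na : \forall y \near within A (nbhs a), `|y - a| <= d / (C + 1).
    apply: cvg_within; have /cvgrPdist_le/(_ _ dC) := @cvg_id _ (nbhs a).
    by apply: filterS => y; rewrite distrC.
  apply: filterS2 (dL _ ltr01) na => y hy ya; rewrite distrC.
  rewrite -[f y - f a](subrK ((y - a) *m L)) (le_trans (ler_normD _ _)) //.
  rewrite -(divfK (lt0r_neq0 C1) d); apply: (@le_trans _ _ ((1 + C) * `|y - a|)).
    by rewrite mulrDl lerD // normr_mulmx_le.
  by rewrite addrC mulrC ler_wpM2r // ltW.
have gB : \forall y \near within A (nbhs a), B (f y) ->
    `|g (f y) - g (f a) - (f y - f a) *m L'| <= e2 * `|f y - f a|.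
  exact: fa (dL' _ e20).
apply: filterS3 (dL _ e10) AB gB => y h1 h2 /(_ h2) h3 /=.
have fya : `|f y - f a| <= (C + 1) * `|y - a|.
  rewrite -[f y - f a](subrK ((y - a) *m L)) (le_trans (ler_normD _ _)) //.
  rewrite addrC mulrDl lerD ?normr_mulmx_le // (le_trans h1) //.
  by rewrite ler_wpM2r.
rewrite mulmxA -[X in `|X|](subrKA ((f y - f a) *m L')) -mulmxBl.
rewrite (le_trans (ler_normD _ _)) // [e]splitr mulrDl lerD //.
  rewrite (le_trans h3) // -e2e -mulrA ler_wpM2l //; exact: ltW.
rewrite (le_trans (normr_mulmx_le _ _)) //.
apply: (@le_trans _ _ (C' * (e1 * `|y - a|))); first by rewrite ler_wpM2l.
by rewrite mulrA ler_wpM2r.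
Qed.

Lemma deriv_within_near m n (A B : set 'rV[R]_m) (f g : 'rV[R]_m -> 'rV[R]_n)
    (a : 'rV[R]_m) (L : 'M[R]_(m, n)) :
  (\forall y \near a, B y -> A y) -> f a = g a ->
  (\forall y \near within B (nbhs a), f y = g y) ->
  has_deriv_within A f a L -> has_deriv_within B g a L.
Proof.
move=> BA fga fg dL e /dL; rewrite !near_withinE in fg *.
apply: filterS3 BA fg => y BAy fgy hy By.
by rewrite -fga -fgy //; apply: hy; exact: BAy.
Qed.

End HalfSpaceDerivative.

(** * The derivative of the flow in charts *)

Section FlowDerivative.
Variables (R : realType) (m : nat) (M : topologicalType).
Variables (S : smooth_manifold R m M) (X : M -> 'rV[R]_m) (Phi : R -> M -> M).
Hypothesis Phi_flow : is_flow S X Phi.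
Implicit Types (p q r x : M) (s t : R).

Local Notation H := (half_space R m).

Definition flow_diff p q t x : 'M[R]_m := local_diff S p q (Phi t) x.

Lemma flow0E : Phi 0 = id.
Proof. by apply/funext => x; rewrite (flow0 Phi_flow). Qed.

Lemma tchangeE p q x : tchange S p q x = flow_diff p q 0 x.
Proof. by rewrite /flow_diff flow0E. Qed.

Lemma dom_nbhs p x : dom S p x -> \forall y \near x, dom S p y.
Proof. by move=> px; apply: open_nbhs_nbhs; split => //; exact: dom_open. Qed.

Lemma flow_cvg t0 x0 : 0 <= t0 ->
  Phi tx.1 tx.2 @[tx --> within [set tx : R * M | 0 <= tx.1] (nbhs (t0, x0))]
    --> Phi t0 x0.
Proof.
move=> t0p; have /subspace_continuousP := flow_continuous Phi_flow.
by move=> /(_ (t0, x0)) /=; apply.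
Qed.

Lemma flow_cvg_point t x0 : 0 <= t -> Phi t x @[x --> x0] --> Phi t x0.
Proof.
move=> t0 B /(@flow_cvg t x0 t0) /= [[A C] [/= tA xC] AC].
apply: filterS xC => x Cx.
by apply: (AC (t, x)) => //; split => //=; exact: nbhs_singleton.
Qed.

Lemma chart_half_space p x : dom S p x -> H (chart S p x).
Proof.
move=> px; have [V _ VE] := chart_image S p.
by have [] : (V `&` H) (chart S p x) by rewrite -VE; exists x.
Qed.

(** The domain of the flow read in charts is a neighbourhood in the half space
    of each of its points. So its derivatives can be taken within the half
    space, where they are unique and the chain rule applies. *)
Lemma near_local_dom p q t x : 0 <= t -> dom S p x -> dom S q (Phi t x) ->
  \forall y \near chart S p x, H y -> local_dom S p q (Phi t) y.
Proof.
move=> t0 px qx; have [V Vop VE] := chart_image S p.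
have Va : V (chart S p x).
  by have [] : (V `&` H) (chart S p x) by rewrite -VE; exists x.
have /subspace_continuousP /(_ (chart S p x)) cc := cinv_continuous (s := S) (p := p).
have qn : \forall z \near x, dom S q (Phi t z).
  by apply: (flow_cvg_point (x0 := x) t0); exact: dom_nbhs.
have : \forall y \near chart S p x, (chart S p @` dom S p) y ->
    dom S q (Phi t (cinv S p y)).
  have xa : (chart S p @` dom S p) (chart S p x) by exists x.
  have cx : cinv S p y @[y --> within (chart S p @` dom S p) (nbhs (chart S p x))]
      --> x by rewrite -[X in _ --> X](chartK px); exact: cc.
  exact: (cx _ qn).
have Vn : \forall y \near chart S p x, V y by exact: open_nbhs_nbhs.
apply: filterS2 Vn => y Vy hy Hy.
have [z pz zy] : (chart S p @` dom S p) y by rewrite VE.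
exists z => //; split => //=.
by rewrite -(chartK pz) zy; apply: hy; exists z.
Qed.

Lemma local_mapE p q (f : M -> M) x : dom S p x ->
  local_map S p q f (chart S p x) = chart S q (f x).
Proof. by move=> px; rewrite /local_map /= chartK. Qed.

Lemma flow_diffP p q t x : 0 <= t -> dom S p x -> dom S q (Phi t x) ->
  has_deriv_within H (local_map S p q (Phi t)) (chart S p x) (flow_diff p q t x).
Proof.
move=> t0 px qx; have [L dL] := flow_C1_diff Phi_flow t0 px qx.
apply: deriv_within_near (near_local_dom t0 px qx) (erefl _) _ _.
  by apply: nearW.
rewrite /flow_diff /local_diff /deriv_within.
by case: xgetP => [L' _ //|/(_ L)].
Qed.

(** The chain rule for [Phi (t + s) = Phi t \o Phi s]. As [Phi 0] is the
    identity, the cases [s = 0] and [t = 0] are the rules for changing charts at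
    the source and at the target. *)
Lemma flow_diff_comp p q r s t x : 0 <= s -> 0 <= t ->
  dom S p x -> dom S q (Phi s x) -> dom S r (Phi (t + s) x) ->
  flow_diff p q s x *m flow_diff q r t (Phi s x) = flow_diff p r (t + s) x.
Proof.
move=> s0 t0 px qx rx.
have rx' : dom S r (Phi t (Phi s x)) by rewrite -(flowD Phi_flow).
apply: half_space_deriv_unique (chart_half_space px) _
  (flow_diffP (addr_ge0 t0 s0) px rx).
have ln : \forall y \near within H (nbhs (chart S p x)), local_dom S p q (Phi s) y.
  exact: near_local_dom.
have := @deriv_within_chain R m m m H H _ (local_map S q r (Phi t)) _ _ _
  (flow_diffP s0 px qx).
rewrite local_mapE // => /(_ _ (flow_diffP t0 qx rx')) dc.
apply: deriv_within_near (dc _).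
- by apply: filterE.
- by rewrite /= !local_mapE // (flowD Phi_flow).
- apply: filterS ln => _ [z [pz /= qz] <-].
  by rewrite /= !local_mapE // (flowD Phi_flow).
- apply: filterS ln => _ [z [pz /= qz] <-].
  by rewrite local_mapE //; exact: chart_half_space.
Qed.

Lemma tchange_id p x : dom S p x -> tchange S p p x = 1%:M.
Proof.
move=> px; rewrite tchangeE.
apply: half_space_deriv_unique (chart_half_space px)
  (flow_diffP (lexx 0) px _) _; first by rewrite flow0E.
rewrite flow0E => e e0.
have ln := near_local_dom (lexx 0) px (_ : dom S p (Phi 0 x)).
have {ln} := ln _; rewrite flow0E => /(_ px).
apply: filterS => y hy /hy [z [pz _] <-].
by rewrite !local_mapE // mulmx1 subrr normr0 mulr_ge0 ?normr_ge0 // ltW.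
Qed.

Lemma tchange_comp p q r x : dom S p x -> dom S q x -> dom S r x ->
  tchange S p q x *m tchange S q r x = tchange S p r x.
Proof.
move=> px qx rx; rewrite !tchangeE.
have := @flow_diff_comp p q r 0 0 x; rewrite !addr0 !flow0E; exact.
Qed.

Lemma tchangeK p q x : dom S p x -> dom S q x ->
  tchange S p q x *m tchange S q p x = 1%:M.
Proof. by move=> px qx; rewrite tchange_comp // tchange_id. Qed.

Lemma flow_diff_target p q r t x : 0 <= t -> dom S p x -> dom S q (Phi t x) ->
  dom S r (Phi t x) ->
  flow_diff p q t x *m tchange S q r (Phi t x) = flow_diff p r t x.
Proof.
move=> t0 px qx rx; rewrite tchangeE.
by rewrite flow_diff_comp ?add0r.
Qed.

Lemma tchange_flow_diff p q r t x : 0 <= t -> dom S p x -> dom S q x ->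
  dom S r (Phi t x) -> tchange S p q x *m flow_diff q r t x = flow_diff p r t x.
Proof.
move=> t0 px qx rx; rewrite tchangeE.
have := @flow_diff_comp p q r 0 t x; rewrite addr0 flow0E; exact.
Qed.

Lemma mdiffE t x : mdiff S (Phi t) x = flow_diff x (Phi t x) t x.
Proof. by []. Qed.

Lemma mdiffD s t x : 0 <= s -> 0 <= t ->
  mdiff S (Phi s) x *m mdiff S (Phi t) (Phi s x) = mdiff S (Phi (t + s)) x.
Proof.
move=> s0 t0; rewrite !mdiffE -(flowD Phi_flow) //.
by apply: flow_diff_comp => //; exact: dom_self.
Qed.

Lemma cvg_flow_diff p q t0 x0 : 0 <= t0 -> dom S p x0 -> dom S q (Phi t0 x0) ->
  flow_diff p q tx.1 tx.2
    @[tx --> within [set tx : R * M | 0 <= tx.1] (nbhs (t0, x0))]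
    --> flow_diff p q t0 x0.
Proof.
move=> t0p px qx.
have /subspace_continuousP /(_ (t0, x0) (And3 t0p px qx)) :=
  flow_C1_cont Phi_flow (p := p) (q := q).
move=> h B /h; rewrite /= => hB.
have {}hB : \forall tx \near (t0, x0),
  [/\ 0 <= tx.1, dom S p tx.2 & dom S q (Phi tx.1 tx.2)] ->
  B (flow_diff p q tx.1 tx.2) by exact: hB.
suff : \forall tx \near (t0, x0), 0 <= tx.1 -> B (flow_diff p q tx.1 tx.2) by [].
have pn : \forall tx \near (t0, x0), dom S p tx.2.
  have : (tx.2 : M) @[tx --> (t0, x0)] --> x0 by exact: cvg_snd.
  by apply; exact: dom_nbhs.
have qn : \forall tx \near (t0, x0), 0 <= tx.1 -> dom S q (Phi tx.1 tx.2).
  by apply: (@flow_cvg t0 x0 t0p); exact: dom_nbhs.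
apply: filterS3 hB pn qn => tx hB ptx qtx tx0; apply: hB.
by split => //; exact: qtx.
Qed.

Lemma cvg_tchange p q x0 : dom S p x0 -> dom S q x0 ->
  tchange S p q x @[x --> x0] --> tchange S p q x0.
Proof.
move=> px qx; rewrite tchangeE; under eq_fun do rewrite tchangeE.
have qx' : dom S q (Phi 0 x0) by rewrite flow0E.
move=> B /(cvg_flow_diff (lexx 0) px qx') /= [[A C] [/= tA xC] AC].
apply: filterS xC => x Cx.
by apply: (AC (0, x)) => //; split => //=; exact: nbhs_singleton.
Qed.

(** The flow maps its orbits to its orbits: the vector field is the velocity of
    [s |-> Phi s x] at [s = 0], and this curve is mapped by [Phi t] to
    [s |-> Phi s (Phi t x)]. *)
Lemma vector_field_invariant t x : 0 <= t ->
  X x *m mdiff S (Phi t) x = X (Phi t x).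
Proof.
move=> t0; set y := Phi t x; set D := mdiff S (Phi t) x.
have dx : dom S x x := dom_self S x.
have dy : dom S y y := dom_self S y.
pose FF : set_system R := within [set s | 0 <= s] (dnbhs (0 : R)).
have velocity z : s^-1 *: (chart S z (Phi s z) - chart S z z) @[s --> FF] --> X z.
  have := flow_deriv Phi_flow (t := 0) (x := z) (lexx 0).
  by rewrite flow0E /=; under eq_fun do rewrite subr0.
have FFf : Filter FF by apply: within_filter.
have FFP : ProperFilter FF.
  apply: Build_ProperFilter_ex => B /nbhs_ballP [r /= r0 hr].
  exists (r / 2); apply: hr; rewrite /ball_ /= ?gt_eqF ?divr_gt0 //.
    by rewrite /ball /= sub0r normrN gtr0_norm ?divr_gt0 // gtr_pMr // invf_lt1 ?ltr1n.
  by rewrite ltW ?divr_gt0.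
have pos : \forall s \near FF, 0 <= s by exact: withinT.
have orbit z : Phi s z @[s --> FF] --> z.
  have z0 : Phi 0 z = z by rewrite flow0E.
  move=> B; rewrite -[X in nbhs X]z0 => /(@flow_cvg 0 z (lexx 0)).
  move=> /= [[A C] [/= A0 zC] AC].
  apply: filterS A0 => s As _ s0; apply: (AC (s, z)) => //.
  by split => //=; exact: nbhs_singleton.
pose c s := chart S x (Phi s x); pose a := chart S x x.
have domx : \forall s \near FF, dom S x (Phi s x) by apply: orbit; exact: dom_nbhs.
have curve : c s @[s --> FF] --> within H (nbhs a).
  have /subspace_continuousP /(_ x dx) cx := chart_continuous (s := S) (p := x).
  move=> B hB.
  have hB' : \forall z \near x, dom S x z -> H (chart S x z) -> B (chart S x z).
    exact: cx _ hB.
  have := orbit x _ hB'; apply: filterS2 domx => s ds; apply => //.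
  exact: chart_half_space.
pose f := local_map S x y (Phi t).
pose P s := s^-1 *: (c s - a); pose Q s := s^-1 *: (chart S y (Phi s y) - chart S y y).
have PX : P s @[s --> FF] --> X x := velocity x.
have Pbound : \forall s \near FF, `|P s| <= `|X x| + 1.
  have /cvgrPdist_le/(_ _ ltr01) := PX; apply: filterS => s; rewrite distrC => Ps.
  by rewrite -[P s](subrK (X x)) (le_trans (ler_normD _ _)) // addrC lerD2l.
have QP : \forall s \near FF, Q s = s^-1 *: (f (c s) - f a).
  apply: filterS2 pos domx => s s0 ds.
  have -> : f (c s) = chart S y (Phi s y).
    by rewrite /f /c local_mapE // /y -!(flowD Phi_flow) // addrC.
  by rewrite /f /a local_mapE.
have lim : Q s @[s --> FF] --> X x *m D.
  have PD : P s *m D @[s --> FF] --> X x *m D by apply: cvg_mulmx => //; exact: cvg_cst.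
  apply/cvgrPdist_le => e e0.
  have e2 : 0 < e / 2 by rewrite divr_gt0.
  pose d := e / 2 / (`|X x| + 1).
  have X1 : 0 < `|X x| + 1 by rewrite ltr_wpDl.
  have d0 : 0 < d by rewrite divr_gt0.
  have hd : \forall s \near FF,
      `|f (c s) - f a - (c s - a) *m D| <= d * `|c s - a|.
    exact: curve _ (flow_diffP t0 dx dy d0).
  have hP : \forall s \near FF, `|X x *m D - P s *m D| <= e / 2 /\
      `|P s| <= `|X x| + 1.
    by have /cvgrPdist_le/(_ _ e2) hP := PD; apply: filterS2 hP Pbound.
  apply: filterS3 hd QP hP => s {}hd -> [hP hb].
  rewrite -[X in `|X|](subrKA (P s *m D)) [e]splitr (le_trans (ler_normD _ _)) // lerD //.
  rewrite distrC.
  have -> : s^-1 *: (f (c s) - f a) - P s *m D =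
      s^-1 *: (f (c s) - f a - (c s - a) *m D).
    by rewrite [RHS]scalerBr scalemxAl.
  rewrite normrZ; apply: (@le_trans _ _ (d * `|P s|)).
    by rewrite /P normrZ mulrCA ler_wpM2l.
  rewrite -[leRHS](divfK (lt0r_neq0 X1)) ler_wpM2l // ltW //.
exact: (cvg_unique _ lim (velocity y)).
Qed.

End FlowDerivative.

(** * Averaging a metric along the flow *)

Lemma cvg_itg_mx (R : realType) m (I : Type) (F : set_system I) (T : R)
    (N : R -> I -> 'M[R]_m) (x0 : I) : Filter F -> 0 < T ->
  (\forall x \near F, forall i j, continuous (fun s => N s x i j)) ->
  (forall i j, continuous (fun s => N s x0 i j)) ->
  (forall s0 : R, N sx.1 sx.2 @[sx --> (nbhs s0, F)] --> N s0 x0) ->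
  itg_mx T (N^~ x) @[x --> F] --> itg_mx T (N^~ x0).
Proof.
move=> FF T0 Nc N0 Ncvg; apply: cvg_mx => i j.
rewrite /itg_mx mxE; under eq_fun do rewrite mxE.
apply: (@cvg_itg _ _ _ _ (fun s x => N s x i j)) => //.
- by apply: filterS Nc => x; apply.
- by move=> s0; apply: cvg_coord; exact: Ncvg.
Qed.

Section AveragedMetric.
Variables (R : realType) (m : nat) (M : topologicalType).
Variables (S : smooth_manifold R m M) (X : M -> 'rV[R]_m) (Phi : R -> M -> M).
Hypothesis Phi_flow : is_flow S X Phi.
Variable G : M -> 'M[R]_m.
Hypothesis G_metric : riemannian_metric S [set: M] G.
Implicit Types (p q x : M) (s t c T : R).

Local Notation flow_diff := (flow_diff S Phi).

Definition pullback s x : 'M[R]_m :=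
  mdiff S (Phi s) x *m G (Phi s x) *m (mdiff S (Phi s) x)^T.

(** The expression in the chart at [p] of a bilinear form on the tangent space
    at [x]. *)
Definition in_chart p x (N : 'M[R]_m) : 'M[R]_m :=
  tchange S p x x *m N *m (tchange S p x x)^T.

(** The maximum extends the integrand continuously to negative times, at which
    the flow need not be differentiable. *)
Definition weighted_pullback c s x : 'M[R]_m :=
  expR (c * s) *: pullback (Num.max s 0) x.

Definition averaged_metric c T x : 'M[R]_m :=
  itg_mx T (fun s => weighted_pullback c s x).

Lemma posdef_metric x : posdef (G x).
Proof. by case: G_metric => Gs Gp _; split; [exact: Gs|move=> v; exact: Gp]. Qed.

Lemma pullback_flow s t x v : 0 <= s -> 0 <= t ->
  qform (pullback s (Phi t x)) (v *m mdiff S (Phi t) x) = qform (pullback (s + t) x) v.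
Proof.
move=> s0 t0; rewrite /pullback -!qform_mul -mulmxA (mdiffD Phi_flow x t0 s0).
by rewrite (flowD Phi_flow).
Qed.

Lemma cvg_metric p x0 : dom S p x0 ->
  in_chart p x (G x) @[x --> x0] --> in_chart p x0 (G x0).
Proof.
move=> px; have [_ _ /(_ p)] := G_metric; rewrite setTI.
move=> /subspace_continuousP /(_ x0 px) h B /h /= hB.
have : \forall x \near x0, dom S p x -> B (in_chart p x (G x)) by exact: hB.
by apply: filterS2 (dom_nbhs px) => x px' ; apply.
Qed.

(** A chart at [Phi s x] can be replaced by any chart around this point. With a
    chart [q] that does not move with [s] and [x], all factors become continuous
    functions of both variables. *)
Lemma in_chart_pullback p q s x : 0 <= s -> dom S p x -> dom S q (Phi s x) ->
  in_chart p x (pullback s x) =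
  flow_diff p q s x *m in_chart q (Phi s x) (G (Phi s x)) *m (flow_diff p q s x)^T.
Proof.
move=> s0 px qx; rewrite /in_chart /pullback mdiffE.
have dy := dom_self S (Phi s x).
have := flow_diff_target Phi_flow s0 px qx dy.
have := tchange_flow_diff Phi_flow s0 px (dom_self S x) dy.
move: (tchange S p x x) (flow_diff x _ s x) (flow_diff p (Phi s x) s x)
  (flow_diff p q s x) (tchange S q _ _) (G _) => A D E D' B N AD D'B.
have conjM (C C' : 'M[R]_m) :
    C *m (C' *m N *m C'^T) *m C^T = (C *m C') *m N *m (C *m C')^T.
  by rewrite trmx_mul !mulmxA.
by rewrite !conjM AD D'B.
Qed.

Lemma cvg_pullback p s0 x0 : 0 <= s0 -> dom S p x0 ->
  in_chart p sx.2 (pullback sx.1 sx.2)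
    @[sx --> within [set sx : R * M | 0 <= sx.1] (nbhs (s0, x0))]
    --> in_chart p x0 (pullback s0 x0).
Proof.
move=> s0p px; pose q := Phi s0 x0; have qx : dom S q (Phi s0 x0) := dom_self S q.
rewrite (in_chart_pullback s0p px qx).
set F := within _ _.
have FF : Filter F by apply: within_filter.
have flow_F := @flow_cvg _ _ _ _ _ _ Phi_flow s0 x0 s0p.
have F0 : \forall sx \near F, 0 <= sx.1 by exact: withinT.
have Fp : \forall sx \near F, dom S p sx.2.
  have : (sx.2 : M) @[sx --> F] --> x0 by apply: cvg_within_filter; exact: cvg_snd.
  by apply; exact: dom_nbhs.
have Fq : \forall sx \near F, dom S q (Phi sx.1 sx.2).
  by apply: flow_F; exact: dom_nbhs.
pose k (sx : R * M) := flow_diff p q sx.1 sx.2 *m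
  in_chart q (Phi sx.1 sx.2) (G (Phi sx.1 sx.2)) *m (flow_diff p q sx.1 sx.2)^T.
apply: cvg_trans (_ : k sx @[sx --> F] --> _).
  apply: near_eq_cvg; apply: filterS3 F0 Fp Fq => sx h0 hp hq.
  by rewrite /k -in_chart_pullback.
have D_F := cvg_flow_diff Phi_flow s0p px qx.
apply: cvg_mulmx; last exact: cvg_trmx.
apply: cvg_mulmx => //.
exact: (cvg_comp _ _ flow_F (cvg_metric qx)).
Qed.

Lemma cvg_weighted_pullback c p s0 x0 : dom S p x0 ->
  in_chart p sx.2 (weighted_pullback c sx.1 sx.2) @[sx --> (s0, x0)]
    --> in_chart p x0 (weighted_pullback c s0 x0).
Proof.
move=> px.
have inZ (a : R) x N : in_chart p x (a *: N) = a *: in_chart p x N.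
  by rewrite /in_chart -scalemxAr -scalemxAl.
rewrite /weighted_pullback inZ; under eq_fun do rewrite inZ.
apply: cvg_scalemx.
  have cs : c * sx.1 @[sx --> (s0, x0)] --> c * s0.
    by apply: cvgM; [exact: cvg_cst|exact: cvg_fst].
  exact: (cvg_comp _ _ cs (@continuous_expR R _)).
have max0 : 0 <= Num.max s0 0 by rewrite le_max lexx orbT.
have maxF : (Num.max sx.1 0, sx.2) @[sx --> (s0, x0)] -->
    within [set sx : R * M | 0 <= sx.1] (nbhs (Num.max s0 0, x0)).
  have h : (Num.max sx.1 0, sx.2) @[sx --> (s0, x0)] --> (Num.max s0 0, x0).
    have mc : Num.max s 0 @[s --> s0] --> Num.max s0 0.
      have s1 : (s, 0 : R) @[s --> s0] --> (s0, 0 : R).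
        by apply: cvg_pair_point; [exact: cvg_id|exact: cvg_cst].
      exact: (cvg_comp _ _ s1 (@max_continuous _ R (s0, 0))).
    have fc : sx.1 @[sx --> (s0, x0)] --> s0 by exact: cvg_fst.
    by apply: cvg_pair_point; [exact: (cvg_comp _ _ fc mc)|exact: cvg_snd].
  move=> B hB.
  have hB' : \forall sx \near (s0, x0),
    0 <= Num.max sx.1 0 -> B (Num.max sx.1 0, sx.2) by exact: h _ hB.
  suff : \forall sx \near (s0, x0), B (Num.max sx.1 0, sx.2) by [].
  by apply: filterS hB' => sx; apply; rewrite le_max lexx orbT.
exact: (cvg_comp _ _ maxF (cvg_pullback max0 px)).
Qed.

Lemma continuous_weighted_pullback c p x : dom S p x ->
  forall i j, continuous (fun s => in_chart p x (weighted_pullback c s x) i j).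
Proof.
move=> px i j s0; apply: cvg_coord.
have sx : (s, x) @[s --> s0] --> (s0, x).
  by apply: cvg_pair_point; [exact: cvg_id|exact: cvg_cst].
exact: (cvg_comp _ _ sx (cvg_weighted_pullback px)).
Qed.

Lemma in_chart_id x N : in_chart x x N = N.
Proof.
by rewrite /in_chart (tchange_id Phi_flow (dom_self S x)) trmx1 mulmx1 mul1mx.
Qed.

Lemma continuous_weight c x :
  forall i j, continuous (fun s => weighted_pullback c s x i j).
Proof.
move=> i j; rewrite (_ : (fun s => _) =
    fun s => in_chart x x (weighted_pullback c s x) i j).
  exact: continuous_weighted_pullback (dom_self S x) _ _.
by apply/funext => s; rewrite in_chart_id.
Qed.

Lemma cvg_averaged_metric c T p x0 : 0 < T -> dom S p x0 ->
  in_chart p x (averaged_metric c T x) @[x --> x0]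
    --> in_chart p x0 (averaged_metric c T x0).
Proof.
move=> T0 px.
have E x : in_chart p x (averaged_metric c T x) =
    itg_mx T (fun s => in_chart p x (weighted_pullback c s x)).
  by rewrite /in_chart /averaged_metric congr_itg //; exact: continuous_weight.
rewrite E; under eq_fun do rewrite E.
apply: (@cvg_itg_mx _ _ _ (nbhs x0) T
  (fun s x => in_chart p x (weighted_pullback c s x))) => //.
- apply: filterS (dom_nbhs px) => x px'; exact: continuous_weighted_pullback.
- exact: continuous_weighted_pullback.
- by move=> s0; exact: cvg_weighted_pullback.
Qed.

Lemma posdef_averaged_metric c T x : 0 < T ->
  (forall s, 0 <= s -> row_free (mdiff S (Phi s) x)) -> posdef (averaged_metric c T x).
Proof.
move=> T0 Dfree; apply: posdef_itg => //; first exact: continuous_weight.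
move=> s; have max0 : 0 <= Num.max s 0 by rewrite le_max lexx orbT.
have [Gs Gp] := posdef_metric (Phi (Num.max s 0) x).
split.
  by rewrite /weighted_pullback /pullback linearZ /= !trmx_mul trmxK Gs mulmxA.
move=> v v0; rewrite /weighted_pullback qformZl.
rewrite mulr_gt0 ?expR_gt0 // /pullback -qform_mul Gp //.
apply: contra v0 => /eqP vD; apply/eqP; apply: (row_free_inj (Dfree _ max0)).
by rewrite vD mul0mx.
Qed.

Definition growth c x v s : R := expR (c * s) * qform (pullback (Num.max s 0) x) v.

Lemma qform_averaged_metric c T x v : 0 < T ->
  qform (averaged_metric c T x) v =
  itg T (growth c x v).
Proof.
move=> T0; rewrite qform_itg //; last exact: continuous_weight.
congr (itg T _); apply/funext => s.
by rewrite /growth /weighted_pullback qformZl.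
Qed.

Lemma continuous_growth c x v : continuous (growth c x v).
Proof.
rewrite (_ : growth c x v = fun s => qform (weighted_pullback c s x) v).
  by apply: continuous_qform; exact: continuous_weight.
by apply/funext => s; rewrite /growth /weighted_pullback qformZl.
Qed.

Lemma qform_averaged_flow c T t x v : 0 < T -> 0 <= t ->
  expR (c * t) * qform (averaged_metric c T (Phi t x)) (v *m mdiff S (Phi t) x) =
  itg T (fun s => growth c x v (s + t)).
Proof.
move=> T0 t0; rewrite qform_averaged_metric // -itgZl; last first.
  exact: continuous_growth.
apply: itg_eq => s /andP[s0 _].
rewrite /growth (max_l (addr_ge0 s0 t0)) (max_l s0) (pullback_flow x v s0 t0).
by rewrite mulrA -expRD -mulrDr addrC.
Qed.

(** Up to the weight [expR (c * t)], moving the base point along the flow moves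
    the window of integration. Hence a decay that is seen only after the whole
    period [T] becomes a decay of the average at all times, with no
    multiplicative constant. *)
Lemma averaged_metric_contract c T t x v : 0 < T -> 0 <= t ->
  (forall s, 0 <= s ->
    expR (c * T) * qform (pullback (s + T) x) v <= qform (pullback s x) v) ->
  expR (c * t) * qform (averaged_metric c T (Phi t x)) (v *m mdiff S (Phi t) x) <=
  qform (averaged_metric c T x) v.
Proof.
move=> T0 t0 h; rewrite (qform_averaged_flow c x v T0 t0).
rewrite (qform_averaged_metric c x v T0).
apply: (itg_translate_le T0 t0 (@continuous_growth c x v)) => s s0.
have sT0 : 0 <= s + T := addr_ge0 s0 (ltW T0).
rewrite /growth (max_l sT0) (max_l s0) mulrDr expRD -mulrA.
exact: (ler_wpM2l (expR_ge0 _) (h s s0)).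
Qed.

Lemma averaged_metric_expand c T t x v : 0 < T -> 0 <= t ->
  (forall s, 0 <= s ->
    qform (pullback s x) v <= expR (c * T) * qform (pullback (s + T) x) v) ->
  qform (averaged_metric c T x) v <=
  expR (c * t) * qform (averaged_metric c T (Phi t x)) (v *m mdiff S (Phi t) x).
Proof.
move=> T0 t0 h; rewrite (qform_averaged_flow c x v T0 t0).
rewrite (qform_averaged_metric c x v T0).
apply: (itg_translate_ge T0 t0 (@continuous_growth c x v)) => s s0.
have sT0 : 0 <= s + T := addr_ge0 s0 (ltW T0).
rewrite /growth (max_l sT0) (max_l s0) mulrDr expRD -mulrA.
exact: (ler_wpM2l (expR_ge0 _) (h s s0)).
Qed.

End AveragedMetric.

(** * Splittings and block metrics *)

Section Splitting.
Variables (R : realType) (m : nat).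
Implicit Types (Es Eu Ps Pu A B D N : 'M[R]_m) (X v : 'rV[R]_m) (xi : 'cV[R]_m).

(** [Ps] and [Pu] are the projections to the stable and unstable summands, and
    [xi] is the coordinate along [X]. *)
Record splitting Es Eu X Ps Pu xi : Prop := Splitting {
  Es_Ps : Es *m Ps = Es; X_Ps : X *m Ps = 0; Eu_Ps : Eu *m Ps = 0;
  Es_Pu : Es *m Pu = 0; X_Pu : X *m Pu = 0; Eu_Pu : Eu *m Pu = Eu;
  Es_xi : Es *m xi = 0; X_xi : X *m xi = 1%:M; Eu_xi : Eu *m xi = 0;
  Ps_sub : (Ps <= Es)%MS; Pu_sub : (Pu <= Eu)%MS;
  resolution : Ps + xi *m X + Pu = 1%:M
}.

Lemma splitting_exists Es Eu X : X != 0 ->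
  (1%:M <= Es + <<X>> + Eu)%MS -> mxdirect (Es + <<X>> + Eu) ->
  exists P : 'M[R]_m * 'M[R]_m * 'cV[R]_m, splitting Es Eu X P.1.1 P.1.2 P.2.
Proof.
move=> X0 full direct.
have Xfree : row_free X.
  by rewrite /row_free eqn_leq rank_leq_row lt0n mxrank_eq0.
have capE : [/\ (Es :&: (<<X>> + Eu))%MS = 0, (Eu :&: (Es + <<X>>))%MS = 0 &
    (<<X>> :&: (Es + Eu))%MS = 0].
  have d3 (U V W : 'M[R]_m) : mxdirect (U + V + W) -> (U :&: (V + W))%MS = 0.
    rewrite !mxdirectE /= -addnA => /eqP rk; apply/mxdirect_addsP.
    rewrite mxdirectE /= addsmxA rk eqn_add2l.
    have le1 := (mxrank_adds_leqif U (V + W)%MS).1.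
    have le2 := (mxrank_adds_leqif V W).1.
    by rewrite eqn_leq le2 andbT -(leq_add2l (\rank U)) -rk -addsmxA.
  have rot (U V W : 'M[R]_m) : mxdirect (U + V + W) -> mxdirect (W + U + V).
    rewrite !mxdirectE /= -!addsmxA (addsmxC W) -addsmxA => /eqP->.
    by rewrite addnC addnA.
  split; first exact: d3.
    by apply: d3; exact: rot.
  by rewrite addsmxC; exact: (d3 _ _ _ (rot _ _ _ (rot _ _ _ direct))).
have [capEs capEu capX] := capE.
pose Ps := proj_mx Es (<<X>> + Eu)%MS; pose Pu := proj_mx Eu (Es + <<X>>)%MS.
pose Px := proj_mx <<X>>%MS (Es + Eu)%MS.
have XX : (X <= <<X>>)%MS by rewrite genmxE.
have Pxsub : (Px <= X)%MS by rewrite -[Px]mul1mx -(genmxE X) proj_mx_sub.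
pose xi := Px *m pinvmx X.
have xiX : xi *m X = Px by rewrite /xi mulmxKpV.
have EsPs : Es *m Ps = Es by rewrite proj_mx_id.
have XPs : X *m Ps = 0 by rewrite proj_mx_0 // (submx_trans XX) // addsmxSl.
have EuPs : Eu *m Ps = 0 by rewrite proj_mx_0 // addsmxSr.
have EsPu : Es *m Pu = 0 by rewrite proj_mx_0 // addsmxSl.
have XPu : X *m Pu = 0 by rewrite proj_mx_0 // (submx_trans XX) // addsmxSr.
have EuPu : Eu *m Pu = Eu by rewrite proj_mx_id.
have EsPx : Es *m Px = 0 by rewrite proj_mx_0 // addsmxSl.
have EuPx : Eu *m Px = 0 by rewrite proj_mx_0 // addsmxSr.
have XPx : X *m Px = X by rewrite proj_mx_id.
exists (Ps, Pu, xi); split => //=.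
- by rewrite /xi mulmxA EsPx mul0mx.
- by rewrite /xi mulmxA XPx mulmxVp.
- by rewrite /xi mulmxA EuPx mul0mx.
- by rewrite -[Ps]mul1mx proj_mx_sub.
- by rewrite -[Pu]mul1mx proj_mx_sub.
rewrite xiX; have /sub_addsmxP[[C1 C2] /= C1E] := full.
have /sub_addsmxP[[C3 C4] /= C3E] := submxMl C1 (Es + <<X>>)%MS.
have /submxP[C5 C5E] : (C4 *m <<X>> <= X)%MS.
  by rewrite -(genmxE X) submxMl.
rewrite -[LHS]mul1mx [in LHS]C1E C3E C5E [RHS]C1E C3E C5E.
rewrite !mulmxDr !mulmxDl -!mulmxA EsPs XPs EuPs EsPu XPu EuPu EsPx XPx EuPx.
by rewrite !mulmx0 !addr0 !add0r.
Qed.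

Section Consequences.
Variables (Es Eu : 'M[R]_m) (X : 'rV[R]_m) (Ps Pu : 'M[R]_m) (xi : 'cV[R]_m).
Hypothesis spl : splitting Es Eu X Ps Pu xi.

Lemma splitting_eq n (N N' : 'M[R]_(m, n)) :
  Es *m N = Es *m N' -> X *m N = X *m N' -> Eu *m N = Eu *m N' -> N = N'.
Proof.
move=> hs hX hu; rewrite -[N]mul1mx -[N']mul1mx -(resolution spl) !mulmxDl.
have /submxP[C ->] := Ps_sub spl; have /submxP[C' ->] := Pu_sub spl.
by rewrite -!mulmxA hs hX hu.
Qed.

Lemma sub_Es n (V : 'M[R]_(n, m)) : (V <= Es)%MS ->
  [/\ V *m Ps = V, V *m Pu = 0 & V *m xi = 0].
Proof.
move=> /submxP[C ->].
by rewrite -!mulmxA (Es_Ps spl) (Es_Pu spl) (Es_xi spl) !mulmx0.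
Qed.

Lemma sub_Eu n (V : 'M[R]_(n, m)) : (V <= Eu)%MS ->
  [/\ V *m Ps = 0, V *m Pu = V & V *m xi = 0].
Proof.
move=> /submxP[C ->].
by rewrite -!mulmxA (Eu_Ps spl) (Eu_Pu spl) (Eu_xi spl) !mulmx0.
Qed.

Lemma sub_center_unstable n (V : 'M[R]_(n, m)) : (V <= <<X>> + Eu)%MS -> V *m Ps = 0.
Proof.
move=> /sub_addsmxP[[C C'] /= ->]; rewrite mulmxDl.
have /submxP[C'' ->] : (C *m <<X>> <= X)%MS by rewrite -(genmxE X) submxMl.
by rewrite -!mulmxA (X_Ps spl) (Eu_Ps spl) !mulmx0 addr0.
Qed.

(** The orthogonal sum of [A] on the stable summand, of [B] on the unstable one
    and of the metric on the flow direction for which [X] is a unit vector. *)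
Definition split_metric A B : 'M[R]_m :=
  Ps *m A *m Ps^T + Pu *m B *m Pu^T + xi *m xi^T.

Lemma conj_split_metric n (e : 'M[R]_(n, m)) A B :
  e *m split_metric A B *m e^T =
  (e *m Ps) *m A *m (e *m Ps)^T + (e *m Pu) *m B *m (e *m Pu)^T +
  (e *m xi) *m (e *m xi)^T.
Proof. by rewrite !trmx_mul !mulmxDr !mulmxDl !mulmxA. Qed.

Lemma qform_split_metric A B v :
  qform (split_metric A B) v =
  qform A (v *m Ps) + qform B (v *m Pu) + (v *m xi) 0 0 ^+ 2.
Proof.
rewrite {1}/qform conj_split_metric !mxE big_ord1.
by rewrite [(v *m xi)^T 0 0]mxE expr2; congr (_ + _ + _); rewrite /qform mxE.
Qed.

Lemma posdef_split_metric A B : posdef A -> posdef B -> posdef (split_metric A B).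
Proof.
move=> Ap Bp; split.
  rewrite /split_metric !linearD /= !trmx_mul !trmxK Ap.1 Bp.1.
  by rewrite !mulmxA.
move=> v v0; rewrite qform_split_metric.
have a0 := qform_ge0 (v *m Ps) Ap; have b0 := qform_ge0 (v *m Pu) Bp.
have c0 := sqr_ge0 ((v *m xi) 0 0).
have [vs|vs] := eqVneq (v *m Ps) 0; last first.
  by rewrite -addrA ltr_pwDl ?Ap.2 // addr_ge0.
have [vu|vu] := eqVneq (v *m Pu) 0; last first.
  by rewrite ltr_pwDl // ltr_wpDl // Bp.2.
rewrite ltr_wpDl ?addr_ge0 // exprn_even_gt0 //=.
apply: contra v0 => /eqP vx.
have -> : v = v *m Ps + v *m xi *m X + v *m Pu.
  by rewrite -mulmxA -!mulmxDr (resolution spl) mulmx1.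
rewrite vs vu (_ : v *m xi = 0) ?mul0mx ?addr0 //.
by apply/matrixP => i j; rewrite !ord1 vx mxE.
Qed.

End Consequences.

Section Transport.
Variables (Es Eu Es' Eu' : 'M[R]_m) (X X' : 'rV[R]_m).
Variables (Ps Pu Ps' Pu' : 'M[R]_m) (xi xi' : 'cV[R]_m) (D : 'M[R]_m).
Hypothesis spl : splitting Es Eu X Ps Pu xi.
Hypothesis spl' : splitting Es' Eu' X' Ps' Pu' xi'.
Hypothesis DEs : (Es *m D :=: Es')%MS.
Hypothesis DX : X *m D = X'.
Hypothesis DEu : (Eu *m D :=: Eu')%MS.

(** The range of [D] contains the three summands at the target. *)
Lemma transport_unitmx : D \in unitmx.
Proof.
rewrite -row_full_unit -sub1mx -(resolution spl') !addmx_sub //.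
- by rewrite (submx_trans (Ps_sub spl')) // -DEs submxMl.
- by rewrite -DX mulmxA submxMl.
- by rewrite (submx_trans (Pu_sub spl')) // -DEu submxMl.
Qed.

Lemma transport_splitting :
  [/\ D *m Ps' = Ps *m D, D *m Pu' = Pu *m D & D *m xi' = xi].
Proof.
have sEs : (Es *m D <= Es')%MS by rewrite DEs.
have sEu : (Eu *m D <= Eu')%MS by rewrite DEu.
have [s1 s2 s3] := sub_Es spl' sEs; have [u1 u2 u3] := sub_Eu spl' sEu.
have X1 : X *m D *m Ps' = 0 by rewrite DX (X_Ps spl').
have X2 : X *m D *m Pu' = 0 by rewrite DX (X_Pu spl').
have X3 : X *m D *m xi' = 1%:M by rewrite DX (X_xi spl').
split; apply: (splitting_eq spl); rewrite !mulmxA.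
- by rewrite s1 (Es_Ps spl).
- by rewrite X1 (X_Ps spl) mul0mx.
- by rewrite u1 (Eu_Ps spl) mul0mx.
- by rewrite s2 (Es_Pu spl) mul0mx.
- by rewrite X2 (X_Pu spl) mul0mx.
- by rewrite u2 (Eu_Pu spl).
- by rewrite s3 (Es_xi spl).
- by rewrite X3 (X_xi spl).
- by rewrite u3 (Eu_xi spl).
Qed.

Variables (A B A' B' : 'M[R]_m) (r : R).
Hypotheses (Ap : posdef A) (Bp : posdef B) (Ap' : posdef A') (Bp' : posdef B').
Hypothesis r1 : 1 <= r.
Hypothesis contractA : forall v, (v <= Es)%MS ->
  r ^+ 2 * qform A' (v *m D) <= qform A v.
Hypothesis expandB : forall v, (v <= Eu)%MS ->
  r ^+ 2 * qform B v <= qform B' (v *m D).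

Local Notation g := (split_metric Ps Pu xi A B).
Local Notation g' := (split_metric Ps' Pu' xi' A' B').

Let r_gt0 : 0 < r := lt_le_trans ltr01 r1.
Let gp : posdef g := posdef_split_metric spl Ap Bp.
Let gp' : posdef g' := posdef_split_metric spl' Ap' Bp'.

Lemma opnorm_stable_le : opnorm g g' Es D <= r^-1.
Proof.
have rV0 : 0 <= r^-1 by rewrite invr_ge0 ltW.
apply: opnorm_le => // v vE; rewrite inorm_leE // !qform_split_metric.
have [D1 D2 D3] := transport_splitting.
rewrite -!(mulmxA v) D1 D2 D3 !mulmxA.
have [-> -> ->] := sub_Es spl vE.
rewrite mul0mx !qform0 mxE expr0n /= !addr0.
by rewrite exprVn mulrC ler_pdivlMr ?exprn_gt0 // mulrC contractA.
Qed.

(** The component along [X] keeps its length, and the unstable one is expanded. *)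
Lemma opnorm_center_unstable_inv_le :
  opnorm g' g ((<<X>> + Eu)%MS *m D) (invmx D) <= 1.
Proof.
apply: opnorm_le => // w /submxP[C ->].
set v := C *m (<<X>> + Eu)%MS.
rewrite mulmxA -/v (mulmxK transport_unitmx) inorm_leE // expr1n mul1r.
rewrite !qform_split_metric.
have [D1 D2 D3] := transport_splitting.
rewrite -!(mulmxA v) D1 D2 D3 !mulmxA.
rewrite (sub_center_unstable spl (submxMl C _)) mul0mx !qform0 !add0r lerD2r.
have vE : (v *m Pu <= Eu)%MS by rewrite (submx_trans (submxMl _ _) (Pu_sub spl)).
apply: le_trans (expandB vE); rewrite ler_peMl ?qform_ge0 //.
by rewrite exprn_ege1.
Qed.

(** On a plane of the center-unstable summand the metric is the square of the
    coordinate along [X], which [D] preserves, plus an unstable part, which [D]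
    stretches; [det_stretch] applies to the Gram matrices. *)
Lemma absdet_plane_ge (L : 'M[R]_m) : (L <= <<X>> + Eu)%MS -> \rank L = 2 ->
  r <= absdet g g' L D.
Proof.
move=> LF rkL.
have [e [[e1 eL] dE]] := absdet_gram L gp gp' transport_unitmx.
have [D1 D2 D3] := transport_splitting.
have ePs : e *m Ps = 0 by apply: (sub_center_unstable spl); rewrite eL.
move: e1; rewrite conj_split_metric ePs !mul0mx add0r addrC => e1.
have d0 : 0 <= absdet g g' L D.
  by rewrite /absdet; case: xgetP => [d _ [? [? [_ _ ->]]]|].
rewrite -(@ler_pXn2r _ 2) ?nnegrE ?(ltW r_gt0) // dE conj_split_metric.
rewrite -!(mulmxA e) D1 D2 D3 !mulmxA ePs !mul0mx add0r addrC.
have Bsym C (N : 'M[R]_m) : N^T = N -> (C *m N *m C^T)^T = C *m N *m C^T.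
  by move=> Ns; rewrite !trmx_mul trmxK Ns mulmxA.
apply: (det_stretch rkL _ _ e1); first by rewrite exprn_ege1.
- by apply: Bsym; exact: Bp'.1.
- by move=> c; rewrite -qform_mul qform_ge0.
- move=> c; rewrite -!qform_mul !mulmxA.
  have cE : (c *m e *m Pu <= Eu)%MS.
    by rewrite (submx_trans (submxMl _ _) (Pu_sub spl)).
  exact: expandB.
Qed.

End Transport.
End Splitting.

(** * Continuity of the splitting in charts *)

Section ContinuityOfSplitting.
Variables (R : realType) (m : nat) (M : topologicalType).
Variables (S : smooth_manifold R m M) (X : M -> 'rV[R]_m) (Phi : R -> M -> M).
Hypotheses (Phi_flow : is_flow S X Phi) (X_C1 : C1_vector_field S X).
Variable Gamma : set M.
Implicit Types (p x : M).

Lemma cvg_vector_field p x0 : dom S p x0 ->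
  X x *m tchange S x p x @[x --> x0] --> X x0 *m tchange S x0 p x0.
Proof.
move=> px; pose a := chart S p x0.
have [V [h [Va [hdiff _] hX]]] : exists V h,
    [/\ open_nbhs a V, class_C 1 V h & forall y, V y -> (chart S p @` dom S p) y ->
      h y = X (cinv S p y) *m tchange S (cinv S p y) p (cinv S p y)].
  by apply: X_C1; exists x0.
have ch : chart S p x @[x --> x0] --> a.
  have /subspace_continuousP /(_ x0 px) cx := chart_continuous (s := S) (p := p).
  move=> B /cx /= hB.
  have hB' : \forall x \near x0, dom S p x -> B (chart S p x) by exact: hB.
  by apply: filterS2 (dom_nbhs px) hB' => x px' ; apply.
have hE x : dom S p x -> V (chart S p x) ->
    X x *m tchange S x p x = h (chart S p x).
  by move=> px' Vx; rewrite hX ?chartK //; exists x.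
have hc : h y @[y --> a] --> h a.
  by apply: differentiable_continuous; apply: hdiff; case: Va.
rewrite (hE x0 px); last by case: Va.
apply: cvg_trans (_ : h (chart S p x) @[x --> x0] --> _).
  apply: near_eq_cvg; apply: filterS2 (dom_nbhs px) (ch _ (open_nbhs_nbhs Va)).
  by move=> x px' Vx; rewrite hE.
exact: (cvg_comp _ _ ch hc).
Qed.

(** The frame that is given in the chart at [x0] is carried to the chart at [p]
    by the change of charts. *)
Lemma subbundle_frame (E : M -> 'M[R]_m) p x0 :
  continuous_subbundle S Gamma E -> Gamma x0 -> dom S p x0 ->
  exists (k : nat) (B : M -> 'M[R]_(k, m)),
    B x @[x --> within (Gamma `&` dom S p) (nbhs x0)] --> B x0 /\
    \forall x \near x0, Gamma x -> (B x :=: E x *m tchange S x p x)%MS.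
Proof.
move=> Econt Gx0 px; have [k [U [B [Ux0 Ux Bc BE]]]] := Econt x0 Gx0.
have dx0 := dom_self S x0.
exists k, (fun x => B x *m tchange S x0 p x); split.
  have /subspace_continuousP Bc' := Bc.
  apply: cvg_mulmx; last first.
    by apply: cvg_within_filter; exact: (cvg_tchange Phi_flow).
  have {}Bc' := Bc' x0 (conj Gx0 (proj2 Ux0)).
  move=> C /Bc' /= hC.
  have hC' : \forall x \near x0, (Gamma `&` U) x -> C (B x) by exact: hC.
  suff : \forall x \near x0, (Gamma `&` dom S p) x -> C (B x) by [].
  by apply: filterS2 (open_nbhs_nbhs Ux0) hC' => x Ux' h [Gx _]; exact: h.
apply: filterS2 (dom_nbhs px) (open_nbhs_nbhs Ux0) => x px' Ux' Gx.
have [_ BEx] := BE x Gx Ux'.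
rewrite -(tchange_comp Phi_flow (dom_self S x) (Ux _ Ux') px') mulmxA.
exact: eqmxMr.
Qed.

Variables (Es Eu : M -> 'M[R]_m).
Hypothesis Es_cont : continuous_subbundle S Gamma Es.
Hypothesis Eu_cont : continuous_subbundle S Gamma Eu.
Variables (Ps Pu : M -> 'M[R]_m) (xi : M -> 'cV[R]_m).
Hypothesis spl : forall x, Gamma x ->
  splitting (Es x) (Eu x) (X x) (Ps x) (Pu x) (xi x).

(** In a chart the projections solve linear systems given by local frames of
    the three bundles, with [X] itself as the frame of the flow direction. *)
Lemma cvg_splitting p x0 : Gamma x0 -> dom S p x0 ->
  let F := within (Gamma `&` dom S p) (nbhs x0) in
  [/\ tchange S p x x *m Ps x *m tchange S x p x @[x --> F]
        --> tchange S p x0 x0 *m Ps x0 *m tchange S x0 p x0,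
      tchange S p x x *m Pu x *m tchange S x p x @[x --> F]
        --> tchange S p x0 x0 *m Pu x0 *m tchange S x0 p x0 &
      tchange S p x x *m xi x @[x --> F] --> tchange S p x0 x0 *m xi x0].
Proof.
move=> Gx0 px F.
have FF : Filter F by apply: within_filter.
have [ks [Bs [Bs_cvg BsE]]] := subbundle_frame Es_cont Gx0 px.
have [ku [Bu [Bu_cvg BuE]]] := subbundle_frame Eu_cont Gx0 px.
pose BX x := X x *m tchange S x p x.
have BX_cvg : BX x @[x --> F] --> BX x0.
  by apply: cvg_within_filter; exact: cvg_vector_field.
pose B x := col_mx (Bs x) (col_mx (BX x) (Bu x)).
have B_cvg : B x @[x --> F] --> B x0 by do 2! apply: cvg_col_mx => //.
have solve x : Gamma x -> dom S p x ->
    (Bs x :=: Es x *m tchange S x p x)%MS -> (Bu x :=: Eu x *m tchange S x p x)%MS ->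
    [/\ B x *m (tchange S p x x *m Ps x *m tchange S x p x) =
          col_mx (Bs x) (0 : 'M[R]_(1 + ku, m)),
        B x *m (tchange S p x x *m Pu x *m tchange S x p x) =
          col_mx 0 (col_mx 0 (Bu x)),
        B x *m (tchange S p x x *m xi x) = col_mx 0 (col_mx 1%:M 0) &
        row_full (B x)].
  move=> Gx px' BsEx BuEx; have sx := spl Gx.
  have tK := tchangeK Phi_flow (dom_self S x) px'.
  have tK' := tchangeK Phi_flow px' (dom_self S x).
  have sfull : (tchange S x p x <= B x)%MS.
    rewrite -[X in (X <= _)%MS]mul1mx -(resolution sx) !mulmxDl !addmx_sub //.
    - rewrite -addsmxE (submx_trans _ (addsmxSl _ _)) // BsEx submxMr //.
      exact: Ps_sub sx.
    - rewrite -!addsmxE (submx_trans _ (addsmxSr _ _)) // -addsmxE.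
      by rewrite (submx_trans _ (addsmxSl _ _)) // -mulmxA submxMl.
    - rewrite -addsmxE (submx_trans _ (addsmxSr _ _)) // -addsmxE.
      rewrite (submx_trans _ (addsmxSr _ _)) // BuEx submxMr //.
      exact: Pu_sub sx.
  move: sfull BsEx BuEx; rewrite /B /BX.
  move: (tchange S p x x) (tchange S x p x) tK tK' => t' t tK tK' sfull BsEx BuEx.
  have /submxP[Cs CsE] : (Bs x <= Es x *m t)%MS by rewrite BsEx.
  have /submxP[Cu CuE] : (Bu x <= Eu x *m t)%MS by rewrite BuEx.
  have tE k n (C : 'M[R]_(k, m)) (E : 'M[R]_m) (N : 'M[R]_(m, n)) :
      C *m (E *m t) *m (t' *m N) = C *m (E *m N).
    by rewrite -!mulmxA (mulmxA t) tK mul1mx.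
  have tX n (N : 'M[R]_(m, n)) : X x *m t *m (t' *m N) = X x *m N.
    by rewrite -!mulmxA (mulmxA t) tK mul1mx.
  split; last by rewrite -sub1mx (submx_trans _ sfull) // -tK' submxMl.
  - rewrite -(mulmxA t') !mul_col_mx CsE CuE !tE tX !(mulmxA _ (Ps x)).
    by rewrite (Es_Ps sx) (X_Ps sx) (Eu_Ps sx) !mul0mx mulmx0 col_mx0.
  - rewrite -(mulmxA t') !mul_col_mx CsE CuE !tE tX !(mulmxA _ (Pu x)).
    by rewrite (Es_Pu sx) (X_Pu sx) (Eu_Pu sx) !mul0mx mulmx0.
  - rewrite !mul_col_mx CsE CuE !tE tX.
    by rewrite (Es_xi sx) (X_xi sx) (Eu_xi sx) !mulmx0.
have near_solve : \forall x \near F, [/\ Gamma x, dom S p x,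
    (Bs x :=: Es x *m tchange S x p x)%MS & (Bu x :=: Eu x *m tchange S x p x)%MS].
  suff : \forall x \near x0, (Gamma `&` dom S p) x -> [/\ Gamma x, dom S p x,
    (Bs x :=: Es x *m tchange S x p x)%MS & (Bu x :=: Eu x *m tchange S x p x)%MS] by [].
  by apply: filterS2 BsE BuE => x hs hu [Gx px']; split => //; [exact: hs|exact: hu].
have [e1 e2 e3 full] := solve x0 Gx0 px (nbhs_singleton BsE Gx0) (nbhs_singleton BuE Gx0).
split.
- apply: (cvg_solve full B_cvg _ _ e1).
    by apply: cvg_col_mx Bs_cvg _; exact: cvg_cst.
  by apply: filterS near_solve => x [Gx px' hs hu]; have [] := solve x Gx px' hs hu.
- apply: (cvg_solve full B_cvg _ _ e2).
    by apply: cvg_col_mx; [exact: cvg_cst|apply: cvg_col_mx Bu_cvg; exact: cvg_cst].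
  by apply: filterS near_solve => x [Gx px' hs hu]; have [] := solve x Gx px' hs hu.
- apply: (cvg_solve full B_cvg _ _ e3); first exact: cvg_cst.
  by apply: filterS near_solve => x [Gx px' hs hu]; have [] := solve x Gx px' hs hu.
Qed.

End ContinuityOfSplitting.

(** * The adapted metric *)

Section HyperbolicRates.
Variables (R : realType) (m : nat) (M : topologicalType).
Variables (S : smooth_manifold R m M) (X : M -> 'rV[R]_m) (Phi : R -> M -> M).
Hypothesis Phi_flow : is_flow S X Phi.
Variables (Gamma : set M) (E : M -> 'M[R]_m) (G : M -> 'M[R]_m).
Hypothesis G_metric : riemannian_metric S [set: M] G.
Hypothesis Gamma_inv : invariant_set Phi Gamma.
Hypothesis E_inv : invariant_subbundle S Phi Gamma E.
Variables (K lambda T : R).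
Hypotheses (K0 : 0 < K) (T0 : 0 < T).
(** [T] is so long that the constant [K] is absorbed by half of the rate. *)
Hypothesis KT : K ^+ 2 * expR (- lambda * T) <= 1.

Lemma invariant_point x t : 0 <= t -> Gamma x -> Gamma (Phi t x).
Proof. by move=> t0 Gx; rewrite -(Gamma_inv t0); exists x. Qed.

Let rate2 : (K * expR (- lambda * T)) ^+ 2 <= expR (- lambda * T).
Proof.
rewrite exprMn [X in _ * X]expr2 mulrA -[leRHS]mul1r.
by rewrite ler_wpM2r ?expR_ge0.
Qed.

Let rate_ge0 : 0 <= K * expR (- lambda * T).
Proof. by rewrite mulr_ge0 ?expR_ge0 ?ltW. Qed.

Let qform_pullback0 x v s : 0 <= s ->
  qform (pullback S Phi G s x) v = qform (G (Phi s x)) (v *m mdiff S (Phi s) x).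
Proof. by rewrite /pullback -qform_mul. Qed.

Let pullback_shift x v s : 0 <= s ->
  qform (pullback S Phi G (s + T) x) v =
  qform (G (Phi T (Phi s x))) (v *m mdiff S (Phi s) x *m mdiff S (Phi T) (Phi s x)).
Proof.
move=> s0; rewrite (addrC s T) -(pullback_flow Phi_flow G x v (ltW T0) s0).
exact: qform_pullback0 (ltW T0).
Qed.

(** The hypothesis on rates is used at the single time [T], at the point
    [Phi s x] of the invariant set: forms are squares of norms, and of the rate
    [2 * lambda] that they inherit one half absorbs [K ^+ 2]. *)
Lemma pullback_decay x s v : Gamma x -> 0 <= s -> (v <= E x)%MS ->
  (forall y, Gamma y -> norm_restr S Phi G E T y <= K * expR (- lambda * T)) ->
  expR (lambda * T) * qform (pullback S Phi G (s + T) x) v <=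
  qform (pullback S Phi G s x) v.
Proof.
move=> Gx s0 vE rate; have Gy := invariant_point s0 Gx.
rewrite [X in _ * X <= _](pullback_shift x v s0).
rewrite [X in _ <= X](qform_pullback0 x v s0).
have wE : (v *m mdiff S (Phi s) x <= E (Phi s x))%MS.
  by rewrite -(E_inv Gx s0) submxMr.
move: (Phi s x) Gy (v *m mdiff S (Phi s) x) wE => y Gy w wE.
have Gp := posdef_metric G_metric.
have := inorm_le_opnorm (G (Phi T y)) (mdiff S (Phi T) y) (Gp y) wE.
move=> /le_trans /(_ (ler_wpM2r (inorm_ge0 _ _) (rate y Gy))).
rewrite inorm_leE ?rate_ge0 // => h; rewrite mulrC -ler_pdivlMr ?expR_gt0 // -expRN mulrC.
by rewrite (le_trans h) // -mulNr ler_wpM2r ?qform_ge0 ?rate2.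
Qed.

Lemma pullback_growth x s v : Gamma x -> 0 <= s -> (v <= E x)%MS ->
  (forall y, Gamma y -> mdiff S (Phi T) y \in unitmx) ->
  (forall y, Gamma y -> norm_restr_inv S Phi G E T y <= K * expR (- lambda * T)) ->
  qform (pullback S Phi G s x) v <=
  expR (- lambda * T) * qform (pullback S Phi G (s + T) x) v.
Proof.
move=> Gx s0 vE unitD rate; have Gy := invariant_point s0 Gx.
rewrite [X in X <= _](qform_pullback0 x v s0).
rewrite [X in _ <= _ * X](pullback_shift x v s0).
have wE : (v *m mdiff S (Phi s) x <= E (Phi s x))%MS.
  by rewrite -(E_inv Gx s0) submxMr.
move: (Phi s x) Gy (v *m mdiff S (Phi s) x) wE => y Gy w wE.
have Gp := posdef_metric G_metric.
have := inorm_le_opnorm (G y) (invmx (mdiff S (Phi T) y)) (Gp (Phi T y))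
  (submxMr (mdiff S (Phi T) y) wE).
move=> /le_trans /(_ (ler_wpM2r (inorm_ge0 _ _) (rate y Gy))).
have wK := mulmxK (unitD y Gy) w.
rewrite wK inorm_leE ?rate_ge0 // => h.
by rewrite (le_trans h) // ler_wpM2r ?qform_ge0 ?rate2.
Qed.

End HyperbolicRates.

Lemma absorbing_time (R : realType) (K lambda : R) : 0 < K -> 0 < lambda ->
  exists2 T : R, 0 < T & K ^+ 2 * expR (- lambda * T) <= 1.
Proof.
move=> K0 l0; exists (K ^+ 2 / lambda); first by rewrite divr_gt0 ?exprn_gt0.
have -> : - lambda * (K ^+ 2 / lambda) = - K ^+ 2 by field; rewrite gt_eqF.
rewrite expRN ler_pdivrMr ?expR_gt0 // mul1r.
by apply: le_trans (expR_ge1Dx _); rewrite lerDr.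
Qed.

Lemma expR_half_sqr (R : realType) (a t : R) : expR (a / 2 * t) ^+ 2 = expR (a * t).
Proof. by rewrite expr2 -expRD -mulrDl -splitr. Qed.

(** In a chart the block metric is the same expression in the projections and
    the forms read in the chart, because inverse changes of charts cancel
    between the factors. *)
Lemma riemannian_split_metric (R : realType) (m : nat) (M : topologicalType)
    (S : smooth_manifold R m M) (X : M -> 'rV[R]_m) (Phi : R -> M -> M)
    (Phi_flow : is_flow S X Phi) (X_C1 : C1_vector_field S X)
    (Gamma : set M) (Es Eu Ps Pu : M -> 'M[R]_m) (xi : M -> 'cV[R]_m)
    (A B : M -> 'M[R]_m) :
  continuous_subbundle S Gamma Es -> continuous_subbundle S Gamma Eu ->
  (forall x, Gamma x -> splitting (Es x) (Eu x) (X x) (Ps x) (Pu x) (xi x)) ->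
  (forall x, Gamma x -> posdef (A x) /\ posdef (B x)) ->
  (forall p x0, dom S p x0 ->
    in_chart S p x (A x) @[x --> x0] --> in_chart S p x0 (A x0) /\
    in_chart S p x (B x) @[x --> x0] --> in_chart S p x0 (B x0)) ->
  riemannian_metric S Gamma (fun x => split_metric (Ps x) (Pu x) (xi x) (A x) (B x)).
Proof.
move=> Esc Euc spl AB ABc.
have gp x : Gamma x -> posdef (split_metric (Ps x) (Pu x) (xi x) (A x) (B x)).
  by move=> Gx; have [Ap Bp] := AB x Gx; exact: (posdef_split_metric (spl x Gx) Ap Bp).
split; [by move=> x /gp []|by move=> x v /gp [_ ]; apply|move=> p].
apply/subspace_continuousP => x0 [Gx0 px].
have [Psc Puc xic] := cvg_splitting Phi_flow X_C1 Esc Euc spl Gx0 px.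
set F := within _ _ in Psc Puc xic *.
have FF : Filter F by apply: within_filter.
have [Ac Bc] := ABc p x0 px.
pose t x := tchange S p x x; pose t' x := tchange S x p x.
pose LP x := t x *m Ps x *m t' x; pose LU x := t x *m Pu x *m t' x.
pose LX x := t x *m xi x.
pose LA x := in_chart S p x (A x); pose LB x := in_chart S p x (B x).
pose local x := LP x *m LA x *m (LP x)^T + LU x *m LB x *m (LU x)^T + LX x *m (LX x)^T.
pose global x :=
  tchange S p x x *m split_metric (Ps x) (Pu x) (xi x) (A x) (B x) *m
    (tchange S p x x)^T.
have localE x : dom S p x -> global x = local x.
  rewrite /global => px'; have tK := tchangeK Phi_flow (dom_self S x) px'.
  rewrite conj_split_metric /local /LP /LU /LX /LA /LB /in_chart /t /t'.
  move: (tchange S p x x) (tchange S x p x) tK => u u' uK.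
  have conjE (P N : 'M[R]_m) : (u *m P *m u') *m (u *m N *m u^T) *m (u *m P *m u')^T =
      (u *m P) *m N *m (u *m P)^T.
    rewrite -[in LHS](mulmxA u N) mulmxA -(mulmxA _ u' u) uK mulmx1.
    rewrite -!mulmxA -trmx_mul -[u *m (P *m u') *m u]mulmxA -(mulmxA P) uK.
    by rewrite mulmx1.
  by rewrite !conjE.
suff : global x @[x --> F] --> global x0 by [].
rewrite (localE _ px); apply: cvg_trans (_ : local x @[x --> F] --> _).
  apply: near_eq_cvg.
  suff : \forall x \near x0, (Gamma `&` dom S p) x -> local x = global x by [].
  by apply: nearW => x [_ px']; rewrite localE.
have conj_cvg (f N : M -> 'M[R]_m) :
    f x @[x --> F] --> f x0 -> N x @[x --> F] --> N x0 ->
    f x *m N x *m (f x)^T @[x --> F] --> f x0 *m N x0 *m (f x0)^T.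
  by move=> fc Nc; apply: cvg_mulmx; [exact: cvg_mulmx|exact: cvg_trmx].
have {}Ac : LA x @[x --> F] --> LA x0 by exact: (cvg_within_filter _ Ac).
have {}Bc : LB x @[x --> F] --> LB x0 by exact: (cvg_within_filter _ Bc).
have Sc := conj_cvg LP LA Psc Ac; have Uc := conj_cvg LU LB Puc Bc.
have Xc : LX x *m (LX x)^T @[x --> F] --> LX x0 *m (LX x0)^T.
  exact: (cvg_mulmx xic (cvg_trmx xic)).
exact: (cvg_addmx (cvg_addmx Sc Uc) Xc).
Qed.

Theorem theorem2 (R : realType) (m : nat) (hm : (3 <= m)%N)
  (M : topologicalType) (S : smooth_manifold R m M)
  (M_compact : compact [set: M]) (M_connected : connected [set: M])
  (X : M -> 'rV[R]_m) (X_C1 : C1_vector_field S X)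
  (X_inward : inward_at_boundary S X)
  (Phi : R -> M -> M) (Phi_flow : is_flow S X Phi)
  (Gamma : set M) (Es Eu : M -> 'M[R]_m)
  (Gamma_hyp : hyperbolic_set S X Phi Gamma Es Eu) :
  exists g : M -> 'M[R]_m,
    sectional_adapted_metric S Phi Gamma
      Es (fun x => (flow_dir X x + Eu x)%MS) g.
Proof.
have [_ Ginv reg split [Esc _ Euc] [Esi _ Eui] rates] := Gamma_hyp.
have [G [G_metric [K [lambda [K0 l0 rate]]]]] := rates.
have [T T0 KT] := absorbing_time K0 l0.
have splits x : exists P : 'M[R]_m * 'M[R]_m * 'cV[R]_m, Gamma x ->
    splitting (Es x) (Eu x) (X x) P.1.1 P.1.2 P.2.
  have [Gx|nGx] := pselect (Gamma x); last by exists (0, 0, 0).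
  have [full direct] := split x Gx.
  by have [P HP] := splitting_exists (reg x Gx) full direct; exists P.
have [P spl] := choice splits.
pose Ps x := (P x).1.1; pose Pu x := (P x).1.2; pose xi x := (P x).2.
have Gflow x (t : R) : 0 <= t -> Gamma x -> Gamma (Phi t x).
  by move=> t0 Gx; exact: (invariant_point Ginv t0 Gx).
have DX x (t : R) : 0 <= t -> X x *m mdiff S (Phi t) x = X (Phi t x).
  by move=> t0; exact: (vector_field_invariant Phi_flow x t0).
have Dunit x (t : R) : 0 <= t -> Gamma x -> mdiff S (Phi t) x \in unitmx.
  move=> t0 Gx; apply: (transport_unitmx (spl _ (Gflow _ _ t0 Gx))).
  - exact: Esi.
  - exact: DX.
  - exact: Eui.
pose A x := averaged_metric S Phi G lambda T x.
pose B x := averaged_metric S Phi G (- lambda) T x.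
have ABp x : Gamma x -> posdef (A x) /\ posdef (B x).
  move=> Gx; split; apply: (posdef_averaged_metric Phi_flow G_metric) => // s s0;
    by rewrite row_free_unit Dunit.
pose g x := split_metric (Ps x) (Pu x) (xi x) (A x) (B x).
exists g; split.
  apply: (riemannian_split_metric Phi_flow X_C1 Esc Euc spl ABp) => p x0 px.
  by split; exact: (cvg_averaged_metric Phi_flow G_metric T0 px).
(* The forms contract at the rate [lambda], hence norms at half this rate. *)
exists (lambda / 2); split; first by rewrite divr_gt0.
move=> x t Gx t_gt0; have t0 := ltW t_gt0; have Gy := Gflow x t t0 Gx.
pose r := expR (lambda / 2 * t).
have r1 : 1 <= r by rewrite -expR0 ler_expR mulr_ge0 // divr_ge0 // ltW.
have r2 : r ^+ 2 = expR (lambda * t) := expR_half_sqr lambda t.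
have rV : expR (- (lambda / 2) * t) = r^-1 by rewrite mulNr expRN.
have [Ap Bp] := ABp x Gx; have [Ap' Bp'] := ABp _ Gy.
have contractA v : (v <= Es x)%MS ->
    r ^+ 2 * qform (A (Phi t x)) (v *m mdiff S (Phi t) x) <= qform (A x) v.
  move=> vE; rewrite r2; apply: (averaged_metric_contract Phi_flow G_metric) => //.
  move=> s s0; apply: (pullback_decay Phi_flow G_metric Ginv Esi K0 T0 KT) => //.
  by move=> y Gy'; have [] := rate y T Gy' T0.
have expandB v : (v <= Eu x)%MS ->
    r ^+ 2 * qform (B x) v <= qform (B (Phi t x)) (v *m mdiff S (Phi t) x).
  move=> vE; rewrite r2 mulrC -ler_pdivlMr ?expR_gt0 // mulrC -expRN -mulNr.
  apply: (averaged_metric_expand Phi_flow G_metric) => //.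
  move=> s s0; apply: (pullback_growth Phi_flow G_metric Ginv Eui K0 T0 KT) => //.
    by move=> y Gy'; apply: Dunit => //; exact: ltW.
  by move=> y Gy'; have [] := rate y T Gy' T0.
have [sx sy] := (spl x Gx, spl _ Gy).
have [DEs DEu] := (Esi x t Gx t0, Eui x t Gx t0); have DXt := DX x t t0.
have stable := opnorm_stable_le sx sy DEs DXt DEu (B (Phi t x)) Ap Bp r1 contractA.
have inverse :=
  opnorm_center_unstable_inv_le sx sy DEs DXt DEu (A x) Bp Ap' Bp' r1 expandB.
have gp := posdef_split_metric sx Ap Bp.
have gp' := posdef_split_metric sy Ap' Bp'.
have stable_ge0 : 0 <= norm_restr S Phi g Es t x by exact: opnorm_ge0 gp.
have inverse_ge0 : 0 <= norm_restr_inv S Phi g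
    (fun x => (flow_dir X x + Eu x)%MS) t x by exact: opnorm_ge0 gp'.
rewrite rV; split.
- have := ler_pM stable_ge0 inverse_ge0 stable inverse; rewrite mulr1; exact.
- exact: stable.
- move=> L LF rkL.
  exact: (absdet_plane_ge sx sy DEs DXt DEu Ap Bp Ap' Bp' r1 expandB LF rkL).
Qed.
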